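(* Let $\lambda$ be an uncountable cardinal satisfying one of the following: (i) $\lambda$ is a limit cardinal and $\lambda^\lambda=\lambda^+$; or (ii) $\lambda$ is a successor cardinal and $\lambda^{<\lambda}<\lambda^\lambda=\lambda^+$. If $\square_\lambda$ holds, then the Ostaszewski square $\clubsuit\square_\lambda$ holds.
   Context: For a set of ordinals $A$: $\operatorname{acc}(A)=\{\alpha\in A:\sup(A\cap\alpha)=\alpha\}$ (for $\alpha$ not the maximum-type trivial case, i.e. $\alpha<\sup A$), $\operatorname{nacc}(A)=A\setminus\operatorname{acc}(A)$; $\operatorname{otp}(A)$ is the order type, and for $i<\operatorname{otp}(A)$, $A(i)$ denotes the unique $\beta\in A$ with $\operatorname{otp}(A\cap\beta)=i$. A $\square_\lambda$-sequence is a sequence $\langle C_\alpha:\alpha<\lambda^+\rangle$ such that for every limit $\alpha<\lambda^+$, $C_\alpha$ is a club subset of $\alpha$ with $\operatorname{otp}(C_\alpha)\le\lambda$, and if $\beta\in\operatorname{acc}(C_\alpha)$ then $C_\beta=C_\alpha\cap\beta$; $\square_\lambda$ asserts that one exists. $\clubsuit\square_\lambda$ (the Ostaszewski square) asserts the existence of a $\square_\lambda$-sequence $\langle C_\alpha:\alpha<\lambda^+\rangle$ such that for every sequence $\langle A_i:i<\lambda\rangle$ of unbounded subsets of $\lambda^+$, every limit ordinal $\theta<\lambda$ and every club $D\subseteq\lambda^+$, there exists $\alpha<\lambda^+$ with $\operatorname{otp}(C_\alpha)=\theta$ such that for all $i<\theta$: (a) $C_\alpha(i+1)\in A_i$, and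 (b) there is $\beta\in D$ with $C_\alpha(i)<\beta<C_\alpha(i+1)$. *)

(* Defs.v *)
(* ordinals/cardinals modelled as well-ordered types. *)
From Stdlib Require Import Classical.
Set Implicit Arguments.

Definition card_le (A B : Type) : Prop :=
  exists f : A -> B, forall x y, f x = f y -> x = y.
Definition card_lt (A B : Type) : Prop := card_le A B /\ ~ card_le B A.
Definition card_eq (A B : Type) : Prop :=
  exists (f : A -> B) (g : B -> A),
    (forall x, g (f x) = x) /\ (forall y, f (g y) = y).

Definition well_order (T : Type) (lt : T -> T -> Prop) : Prop :=
  (forall x, ~ lt x x) /\
  (forall x y z, lt x y -> lt y z -> lt x z) /\
  (forall x y, lt x y \/ x = y \/ lt y x) /\
  well_founded lt.

Definition seg (T : Type) (lt : T -> T -> Prop) (x : T) : Type := {y : T | lt y x}.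

Definition is_cardinal (T : Type) (lt : T -> T -> Prop) : Prop :=
  well_order lt /\ forall x : T, ~ card_le T (seg lt x).

Definition uncountable (T : Type) : Prop := ~ card_le T nat.

Definition is_successor_cardinal_of (L : Type) (ltL : L -> L -> Prop)
  (K : Type) (ltK : K -> K -> Prop) : Prop :=
  is_cardinal ltK /\ card_lt L K /\ forall x : K, card_le (seg ltK x) L.

Definition limit_cardinal (L : Type) (ltL : L -> L -> Prop) : Prop :=
  forall x : L, exists y : L, card_lt (seg ltL x) (seg ltL y).

Definition successor_cardinal (L : Type) (ltL : L -> L -> Prop) : Prop :=
  exists x : L, forall y : L, card_le (seg ltL y) (seg ltL x).

(* a type of cardinality lambda^{<lambda} = | U_{alpha<lambda} ^alpha lambda | *)
Definition lt_power (L : Type) (ltL : L -> L -> Prop) : Type :=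
  {x : L & (seg ltL x -> L)}.

Definition is_limit (T : Type) (lt : T -> T -> Prop) (a : T) : Prop :=
  (exists b, lt b a) /\ forall b, lt b a -> exists c, lt b c /\ lt c a.

Definition accum (T : Type) (lt : T -> T -> Prop) (A : T -> Prop) (b : T) : Prop :=
  (exists c, lt c b) /\ forall c, lt c b -> exists d, A d /\ lt c d /\ lt d b.

Definition in_acc (T : Type) (lt : T -> T -> Prop) (A : T -> Prop) (b : T) : Prop :=
  A b /\ accum lt A b.

Definition club_in (T : Type) (lt : T -> T -> Prop) (C : T -> Prop) (a : T) : Prop :=
  (forall b, C b -> lt b a) /\
  (forall b, lt b a -> exists d, C d /\ lt b d) /\
  (forall b, lt b a -> accum lt C b -> C b).

Definition club (T : Type) (lt : T -> T -> Prop) (D : T -> Prop) : Prop :=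
  (forall b, exists d, D d /\ lt b d) /\
  (forall b, accum lt D b -> D b).

Definition unbounded (T : Type) (lt : T -> T -> Prop) (A : T -> Prop) : Prop :=
  forall b, exists d, A d /\ lt b d.

Definition otp_le (L : Type) (ltL : L -> L -> Prop) (K : Type) (ltK : K -> K -> Prop)
  (C : K -> Prop) : Prop :=
  exists f : K -> L, forall b c, C b -> C c -> ltK b c -> ltL (f b) (f c).

Definition enumerates (L : Type) (ltL : L -> L -> Prop) (K : Type) (ltK : K -> K -> Prop)
  (C : K -> Prop) (theta : L) (e : L -> K) : Prop :=
  (forall i j, ltL i j -> ltL j theta -> ltK (e i) (e j)) /\
  (forall b, C b <-> exists i, ltL i theta /\ e i = b).

Definition succ_of (T : Type) (lt : T -> T -> Prop) (i j : T) : Prop :=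
  lt i j /\ forall k, lt i k -> ~ lt k j.

(* C is a square_lambda sequence  <C_a : a < lambda^+>  (C a b means b \in C_a) *)
Definition square_seq (L : Type) (ltL : L -> L -> Prop) (K : Type) (ltK : K -> K -> Prop)
  (C : K -> K -> Prop) : Prop :=
  forall a, is_limit ltK a ->
    club_in ltK (C a) a /\ otp_le ltL ltK (C a) /\
    forall b, in_acc ltK (C a) b -> forall g, C b g <-> (C a g /\ ltK g b).

Definition square (L : Type) (ltL : L -> L -> Prop) (K : Type) (ltK : K -> K -> Prop) : Prop :=
  exists C : K -> K -> Prop, square_seq ltL ltK C.

Definition clubsuit_square (L : Type) (ltL : L -> L -> Prop) (K : Type) (ltK : K -> K -> Prop)
  : Prop :=
  exists C : K -> K -> Prop, square_seq ltL ltK C /\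
    forall (A : L -> K -> Prop), (forall i, unbounded ltK (A i)) ->
    forall theta : L, is_limit ltL theta ->
    forall D : K -> Prop, club ltK D ->
    exists a : K, is_limit ltK a /\
      exists e : L -> K, enumerates ltL ltK (C a) theta e /\
      forall i j, ltL i theta -> succ_of ltL i j ->
        A i (e j) /\ exists b, D b /\ ltK (e i) b /\ ltK b (e j).

(* Main.v *)
From Stdlib Require Import Classical ClassicalEpsilon FunctionalExtensionality
  PropExtensionality List Arith Lia Wellfounded Relation_Operators Lexicographic_Product.
Require Import Defs.
Set Implicit Arguments.

(** Since lambda^lambda = lambda^+, ordinals below lambda^+ code conjectures about lambda^2
    sequences of unbounded sets, and at each point b of C_a the conjectures coded below b get
    indices below lambda.  Given mu < lambda and sequences of sets Z_e (e < tau), walk along C_a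
    and use at b those conjectures of index below mu which are right about all Z_e; each predicts
    the next point of the set guessed at tau.  The walk uses at most one new point below each
    point of C_a and looks only at C_a below it, so the new points with their limits again form
    a square sequence.

    If this fails for all mu and tau, let Z_tau be the counterexample at stage tau.  Take a of large
    cofinality, closed under the functions involved.  Some mu bounds the indices
    of the correct conjectures at theta many points of C_a.  Each conjecture is refuted at no more than
    one stage tau, and a bounded part of C_a has fewer than lambda points, so at some stage tau < lambda
    no surviving conjecture of index below mu is refuted.  At that stage the walk
    reaches length theta and all its predictions are right, a contradiction (this is Shelah's
    argument for the diamond from 2^lambda = lambda^+).

    To treat all theta with one sequence, the parameters for theta are read off the minimum of C_a,
    after cutting all C_a at one ordinal eps for which each value of theta is coded by the minima of
    stationarily many C_a of the right cofinality. *)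

(** * Recursion and choice principles *)

(** Transfinite recursion in which each value is only chosen subject to a condition on the earlier
    ones. The last hypothesis makes the condition local, so the history may be a total function,
    filled up by the default [v0] outside the segment. *)
Lemma wf_rec_choice (T V : Type) (lt : T -> T -> Prop) (P : T -> (T -> V) -> V -> Prop) :
  inhabited V -> well_founded lt ->
  (forall t Z, exists v, P t Z v) ->
  (forall t Z Z' v, (forall s, lt s t -> Z s = Z' s) -> P t Z v -> P t Z' v) ->
  exists Z, forall t, P t Z (Z t).
Proof.
  intros [v0] wf ex ext.
  pose (G := fun t (rec : forall s, lt s t -> V) (s : T) =>
               match excluded_middle_informative (lt s t) with
               | left h => rec s h | right _ => v0 end).
  pose (F := fun t rec => proj1_sig (constructive_indefinite_description _ (ex t (@G t rec)))).
  pose (Z := Fix wf (fun _ => V) F).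
  exists Z; intro t.
  assert (E : Z t = F t (fun s _ => Z s)).
  { unfold Z at 1. rewrite Fix_eq; [reflexivity|].
    intros x f g fg. replace g with f; [reflexivity|].
    extensionality y. extensionality p. apply fg. }
  rewrite E. unfold F.
  destruct (constructive_indefinite_description _ _) as [v hv]; simpl.
  apply ext with (2 := hv). intros s hs. unfold G.
  destruct (excluded_middle_informative _); [reflexivity|contradiction].
Qed.

Lemma func_choice (A B : Type) (R : A -> B -> Prop) :
  (forall a, exists b, R a b) -> exists f, forall a, R a (f a).
Proof.
  intro h.
  exists (fun a => proj1_sig (constructive_indefinite_description _ (h a))).
  intro a. destruct (constructive_indefinite_description _ _); assumption.
Qed.

Lemma partial_choice (A B : Type) (Q : A -> Prop) (R : A -> B -> Prop) :
  inhabited B -> (forall a, Q a -> exists b, R a b) ->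
  exists f, forall a, Q a -> R a (f a).
Proof.
  intros [b0] h. apply (func_choice (fun a b => Q a -> R a b)).
  intro a. destruct (classic (Q a)) as [q|nq].
  - destruct (h a q) as [b hb]. exists b; auto.
  - exists b0; contradiction.
Qed.

Lemma sig_eq (T : Type) (P : T -> Prop) (x y : {t | P t}) :
  proj1_sig x = proj1_sig y -> x = y.
Proof.
  destruct x as [x hx], y as [y hy]; simpl; intros ->.
  f_equal; apply proof_irrelevance.
Qed.

(** * Cardinalities *)

Lemma card_le_refl (A : Type) : card_le A A.
Proof. exists (fun a => a); auto. Qed.

Lemma card_le_trans (A B C : Type) : card_le A B -> card_le B C -> card_le A C.
Proof.
  intros [f hf] [g hg]. exists (fun a => g (f a)). intros x y e. apply hf, hg, e.
Qed.

Lemma card_le_prod (A B A' B' : Type) :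
  card_le A A' -> card_le B B' -> card_le (A * B) (A' * B').
Proof.
  intros [f hf] [g hg]. exists (fun p => (f (fst p), g (snd p))).
  intros [a b] [a' b'] e; simpl in e. injection e as e1 e2. f_equal; auto.
Qed.

Lemma card_le_option (A B : Type) : card_le A B -> card_le (option A) (option B).
Proof.
  intros [f hf]. exists (option_map f).
  intros [a|] [b|] e; simpl in e; try discriminate; auto.
  injection e as e. f_equal; auto.
Qed.

Lemma card_le_rel (A B : Type) (R : A -> B -> Prop) :
  (forall a, exists b, R a b) -> (forall a a' b, R a b -> R a' b -> a = a') -> card_le A B.
Proof.
  intros ex inj. destruct (func_choice R ex) as [f hf].
  exists f. intros x y e. apply (inj x y (f x)); [apply hf|rewrite e; apply hf].
Qed.

Definition finite (A : Type) : Prop := exists l : list A, forall a, In a l.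

Lemma finite_card_le (A B : Type) : card_le A B -> finite B -> finite A.
Proof.
  intros [f hf] [l hl].
  destruct (classic (inhabited A)) as [[a0]|no].
  2:{ exists nil. intro a. destruct no; constructor; exact a. }
  destruct (@partial_choice B A (fun b => exists a, f a = b) (fun b a => f a = b)) as [g hg].
  - constructor; exact a0.
  - auto.
  - exists (map g l). intro a. apply in_map_iff. exists (f a). split; [|apply hl].
    apply hf, hg. exists a; reflexivity.
Qed.

Lemma finite_prod (A B : Type) : finite A -> finite B -> finite (A * B).
Proof.
  intros [l hl] [m hm]. exists (list_prod l m). intros [a b]. apply in_prod; auto.
Qed.

Lemma finite_option (A : Type) : finite A -> finite (option A).
Proof.
  intros [l hl]. exists (None :: map (@Some A) l).
  intros [a|]; [right; apply in_map, hl|left; reflexivity].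
Qed.

Lemma finite_countable (A : Type) : finite A -> card_le A nat.
Proof.
  intros [l hl]. apply card_le_rel with (R := fun a n => nth_error l n = Some a).
  - intro a. apply In_nth_error, hl.
  - intros a a' n e e'. congruence.
Qed.

Lemma infinite_nat (A : Type) : ~ finite A -> card_le nat A.
Proof.
  intro inf.
  assert (exA : inhabited A).
  { apply NNPP. intro no. apply inf. exists nil. intro a. destruct no; constructor; exact a. }
  destruct (@wf_rec_choice nat A Nat.lt (fun n Z a => forall m, m < n -> Z m <> a)) as [Z hZ].
  - exact exA.
  - apply lt_wf.
  - intros n Z. apply NNPP. intro no. apply inf. exists (map Z (seq 0 n)).
    intro a. apply NNPP. intro na. apply no. exists a. intros m hm e. apply na.
    rewrite <- e. apply in_map, in_seq. lia.
  - intros n Z Z' a e h m hm. rewrite <- (e m hm). auto.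
  - exists Z. intros x y e. destruct (Nat.lt_trichotomy x y) as [h|[h|h]]; auto.
    + destruct (hZ y x h e).
    + destruct (hZ x y h (eq_sym e)).
Qed.

Lemma option_square (A : Type) : ~ finite A -> card_le (option A) (A * A).
Proof.
  intro inf. destruct (infinite_nat inf) as [f hf].
  assert (ne : f 0 <> f 1) by (intro e; apply hf in e; discriminate).
  exists (fun o => match o with None => (f 0, f 1) | Some a => (a, a) end).
  intros [a|] [b|] e; try congruence.
Qed.

Definition idem (A : Type) : Prop := card_le (A * A) A.

Lemma idem_option (A : Type) : ~ finite A -> idem A -> card_le (option A) A.
Proof. intros inf h. apply card_le_trans with (1 := option_square inf), h. Qed.

(** * Well-orders *)

Lemma wo_irr (T : Type) (lt : T -> T -> Prop) : well_order lt -> forall x, ~ lt x x.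
Proof. intros [h _]; exact h. Qed.

Lemma wo_trans (T : Type) (lt : T -> T -> Prop) : well_order lt ->
  forall x y z, lt x y -> lt y z -> lt x z.
Proof. intros [_ [h _]]; exact h. Qed.

Lemma wo_tri (T : Type) (lt : T -> T -> Prop) : well_order lt ->
  forall x y, lt x y \/ x = y \/ lt y x.
Proof. intros [_ [_ [h _]]]; exact h. Qed.

Lemma wo_wf (T : Type) (lt : T -> T -> Prop) : well_order lt -> well_founded lt.
Proof. intros [_ [_ [_ h]]]; exact h. Qed.

Lemma wo_lt_le_trans (T : Type) (lt : T -> T -> Prop) : well_order lt ->
  forall x y z, lt x y -> ~ lt z y -> lt x z.
Proof.
  intros H x y z h1 h2. destruct (wo_tri H y z) as [h|[<-|h]]; auto; try contradiction.
  apply (wo_trans H) with y; auto.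
Qed.

Lemma wo_le_lt_trans (T : Type) (lt : T -> T -> Prop) : well_order lt ->
  forall x y z, ~ lt y x -> lt y z -> lt x z.
Proof.
  intros H x y z h1 h2. destruct (wo_tri H x y) as [h| [<-|h]]; auto; try contradiction.
  apply (wo_trans H) with y; auto.
Qed.

Lemma wo_le_trans (T : Type) (lt : T -> T -> Prop) : well_order lt ->
  forall x y z, ~ lt y x -> ~ lt z y -> ~ lt z x.
Proof. intros H x y z h1 h2 h. apply h2. apply (wo_lt_le_trans H) with x; auto. Qed.

Lemma wo_le_antisym (T : Type) (lt : T -> T -> Prop) : well_order lt ->
  forall x y, ~ lt y x -> ~ lt x y -> x = y.
Proof. intros H x y h1 h2. destruct (wo_tri H x y) as [h|[h|h]]; auto; contradiction. Qed.

Arguments wo_irr {T lt} H {x} _.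
Arguments wo_trans {T lt} H {x y z} _ _.
Arguments wo_tri {T lt} H x y.
Arguments wo_lt_le_trans {T lt} H {x y z} _ _.
Arguments wo_le_lt_trans {T lt} H {x y z} _ _.
Arguments wo_le_trans {T lt} H {x y z} _ _ _.
Arguments wo_le_antisym {T lt} H {x y} _ _.

Ltac have_new P pf :=
  lazymatch goal with
  | _ : P |- _ => fail
  | _ => assert P by exact pf
  end.

(* Decides order goals by refutation, saturating the hypotheses under transitivity;
   weak inequalities [x <= y] are written [~ lt y x]. *)
Ltac ord H :=
  lazymatch type of H with
  | @well_order ?T ?lt =>
    try (apply (wo_le_antisym H));
    try (apply NNPP; intro);
    try intro;
    repeat match goal with
    | h : ~ ~ lt _ _ |- _ => apply NNPP in h
    end;
    repeat match goal with
    | h : lt ?a ?a |- _ => exfalso; exact (wo_irr H h)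
    | h : lt ?a ?b, h' : ~ lt ?a ?b |- _ => exfalso; exact (h' h)
    | h : lt ?a ?b, h' : lt ?b ?c |- _ => have_new (lt a c) (@wo_trans T lt H a b c h h')
    | h : lt ?a ?b, h' : ~ lt ?c ?b |- _ => have_new (lt a c) (@wo_lt_le_trans T lt H a b c h h')
    | h : ~ lt ?b ?a, h' : lt ?b ?c |- _ => have_new (lt a c) (@wo_le_lt_trans T lt H a b c h h')
    | h : ~ lt ?b ?a, h' : ~ lt ?c ?b |- _ => have_new (~ lt c a) (@wo_le_trans T lt H a b c h h')
    end; fail
  end.

Lemma wo_least (T : Type) (lt : T -> T -> Prop) (P : T -> Prop) : well_order lt ->
  (exists x, P x) -> exists x, P x /\ forall y, P y -> ~ lt y x.
Proof.
  intros H [x hx]. revert hx. induction (wo_wf H x) as [x _ IH]. intro hx.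
  destruct (classic (exists y, P y /\ lt y x)) as [[y [hy l]]|no].
  - exact (IH y l hy).
  - exists x. split; auto. intros y hy l. apply no. eauto.
Qed.

Lemma seg_mono (T : Type) (lt : T -> T -> Prop) : well_order lt ->
  forall x y, ~ lt y x -> card_le (seg lt x) (seg lt y).
Proof.
  intros H x y h.
  exists (fun z : seg lt x => exist (fun t => lt t y) (proj1_sig z)
                                   (wo_lt_le_trans H (proj2_sig z) h)).
  intros a b e. apply sig_eq. injection e; auto.
Qed.

Lemma closed_seg_option (T : Type) (lt : T -> T -> Prop) : well_order lt ->
  forall x, card_le {y | ~ lt x y} (option (seg lt x)).
Proof.
  intros H x.
  apply card_le_rel with (R := fun y o => match o with
     | None => proj1_sig y = x | Some z => proj1_sig y = proj1_sig z end).
  - intros [y hy]. destruct (wo_tri H y x) as [h|[h|h]]; simpl.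
    + exists (Some (exist (fun t => lt t x) y h)); reflexivity.
    + exists None; exact h.
    + contradiction.
  - intros a b [z|] e e'; apply sig_eq; congruence.
Qed.

Lemma seg_well_order (T : Type) (lt : T -> T -> Prop) (x : T) : well_order lt ->
  well_order (fun a b : seg lt x => lt (proj1_sig a) (proj1_sig b)).
Proof.
  intro H. refine (conj _ (conj _ (conj _ _))).
  - intro a; apply (wo_irr H).
  - intros a b c; apply (wo_trans H).
  - intros a b. destruct (wo_tri H (proj1_sig a) (proj1_sig b)) as [h|[h|h]]; auto.
    right; left; apply sig_eq, h.
  - apply (wf_inverse_image _ _ lt (fun a : seg lt x => proj1_sig a)), (wo_wf H).
Qed.

Lemma seg_seg (T : Type) (lt : T -> T -> Prop) (x : T) : well_order lt -> forall z : seg lt x,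
  card_le (seg (fun a b : seg lt x => lt (proj1_sig a) (proj1_sig b)) z)
          (seg lt (proj1_sig z)) /\
  card_le (seg lt (proj1_sig z))
          (seg (fun a b : seg lt x => lt (proj1_sig a) (proj1_sig b)) z).
Proof.
  intros H z. split.
  - exists (fun y => exist (fun t => lt t (proj1_sig z)) (proj1_sig (proj1_sig y)) (proj2_sig y)).
    intros a b e. apply sig_eq, sig_eq. injection e; auto.
  - exists (fun y => exist (fun a : seg lt x => lt (proj1_sig a) (proj1_sig z))
              (exist (fun t => lt t x) (proj1_sig y)
                     (wo_trans H (proj2_sig y) (proj2_sig z)))
              (proj2_sig y)).
    intros a b e. apply sig_eq. injection e; auto.
Qed.

(** * Hessenberg's theorem: infinite cardinals equal their squares *)

Section Hessenberg.
Variables (T : Type) (lt : T -> T -> Prop).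
Hypothesis H : well_order lt.

Let mx (p : T * T) : T :=
  if excluded_middle_informative (lt (fst p) (snd p)) then snd p else fst p.

Lemma fst_le_mx p : ~ lt (mx p) (fst p).
Proof. unfold mx; destruct (excluded_middle_informative _); ord H. Qed.

Lemma snd_le_mx p : ~ lt (mx p) (snd p).
Proof. unfold mx; destruct (excluded_middle_informative _); ord H. Qed.

(** Goedel's well-ordering of pairs: by maximum first, then lexicographically. The predecessors of a
    pair thus lie in the square of a closed initial segment. *)
Definition godel : T * T -> T * T -> Prop :=
  fun p q => slexprod _ _ lt (slexprod _ _ lt lt) (mx p, p) (mx q, q).

Lemma godel_wf : well_founded godel.
Proof.
  apply (wf_inverse_image _ _ (slexprod _ _ lt (slexprod _ _ lt lt)) (fun p => (mx p, p))).
  repeat apply wf_slexprod; apply (wo_wf H).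
Qed.

Lemma slexprod_tri (A B : Type) (ra : A -> A -> Prop) (rb : B -> B -> Prop) :
  (forall x y, ra x y \/ x = y \/ ra y x) -> (forall x y, rb x y \/ x = y \/ rb y x) ->
  forall p q, slexprod _ _ ra rb p q \/ p = q \/ slexprod _ _ ra rb q p.
Proof.
  intros ha hb [a b] [c d]. destruct (ha a c) as [h|[<-|h]].
  - left; constructor; exact h.
  - destruct (hb b d) as [h|[<-|h]]; [left|right; left|right; right]; auto;
      constructor 2; exact h.
  - right; right; constructor; exact h.
Qed.

Lemma godel_tri p q : godel p q \/ p = q \/ godel q p.
Proof.
  destruct (slexprod_tri _ _ (wo_tri H) (slexprod_tri _ _ (wo_tri H) (wo_tri H)) (mx p, p) (mx q, q))
    as [h|[h|h]]; auto.
  right; left; injection h; auto.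
Qed.

Lemma godel_mx p q : godel q p -> ~ lt (mx p) (mx q).
Proof. intro h. inversion h; subst; ord H. Qed.

(** Recursion along [godel] sends each pair to a value not yet used. One is always left: the
    predecessors of [p] lie in the square of the points up to [mx p], which by the hypothesis on
    segments is too small to cover the cardinal [T]. *)
Lemma hessenberg_step : is_cardinal lt -> ~ finite T ->
  (forall x, ~ finite (seg lt x) -> idem (seg lt x)) -> idem T.
Proof.
  intros [_ card] inf IH.
  assert (small : forall m, ~ card_le T ({y | ~ lt m y} * {y | ~ lt m y})).
  { intros m c. destruct (classic (finite (seg lt m))) as [f|nf].
    - apply inf. apply finite_card_le with (1 := c).
      assert (finite {y | ~ lt m y}).
      { apply finite_card_le with (1 := closed_seg_option H m), finite_option, f. }
      apply finite_prod; assumption.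
    - apply (card m). apply card_le_trans with (1 := c).
      assert (card_le {y | ~ lt m y} (seg lt m)).
      { apply card_le_trans with (1 := closed_seg_option H m).
        apply idem_option; auto. }
      apply card_le_trans with (2 := IH m nf). apply card_le_prod; assumption. }
  assert (exT : inhabited T).
  { destruct (infinite_nat inf) as [f _]. constructor; exact (f 0). }
  destruct (@wf_rec_choice (T * T) T godel (fun p Z t => forall q, godel q p -> Z q <> t))
    as [Z hZ]; auto.
  - apply godel_wf.
  - intros p Z. apply NNPP. intro no. apply (small (mx p)).
    apply card_le_rel with (R := fun t q =>
       godel (proj1_sig (fst q), proj1_sig (snd q)) p /\
       Z (proj1_sig (fst q), proj1_sig (snd q)) = t).
    + intro t. apply NNPP. intro nt. apply no. exists t. intros q hq e. apply nt.
      assert (l := godel_mx hq). assert (l1 := fst_le_mx q). assert (l2 := snd_le_mx q).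
      assert (h1 : ~ lt (mx p) (fst q)) by ord H.
      assert (h2 : ~ lt (mx p) (snd q)) by ord H.
      exists (exist _ (fst q) h1, exist _ (snd q) h2). simpl.
      destruct q; simpl in *; auto.
    + intros a b q [_ e] [_ e']; congruence.
  - intros p Z Z' t e h q hq. rewrite <- (e q hq). auto.
  - exists Z. intros p q e. destruct (godel_tri p q) as [h|[h|h]]; auto.
    + destruct (hZ q p h e).
    + destruct (hZ p q h (eq_sym e)).
Qed.
End Hessenberg.

(** The least [y] whose segment is as large as that of [x] makes [seg lt y] a cardinal, so the step
    for cardinals applies to it, with the induction hypothesis for its segments. *)
Lemma hessenberg_seg (T : Type) (lt : T -> T -> Prop) : well_order lt ->
  forall x, ~ finite (seg lt x) -> idem (seg lt x).
Proof.
  intros H x. induction (wo_wf H x) as [x _ IH]. intro inf.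
  destruct (@wo_least T lt (fun y => card_le (seg lt x) (seg lt y)) H) as [y [hy min]].
  { exists x; apply card_le_refl. }
  assert (yx : ~ lt x y) by (apply min, card_le_refl).
  assert (infy : ~ finite (seg lt y)).
  { intro f; apply inf; apply finite_card_le with (1 := hy) (2 := f). }
  enough (I : idem (seg lt y)).
  { apply card_le_trans with (1 := card_le_prod hy hy).
    apply card_le_trans with (1 := I). apply (seg_mono H), yx. }
  apply (hessenberg_step (seg_well_order y H)); auto.
  - split; [apply (seg_well_order y H)|].
    intros z c. apply (min (proj1_sig z)); [|apply (proj2_sig z)].
    apply card_le_trans with (1 := hy), card_le_trans with (1 := c), (seg_seg H z).
  - intros z nf. destruct (seg_seg H z) as [c1 c2].
    apply card_le_trans with (1 := card_le_prod c1 c1).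
    apply card_le_trans with (2 := c2). apply IH.
    + assert (l : lt (proj1_sig z) y) by exact (proj2_sig z). ord H.
    + intro f; apply nf; apply finite_card_le with (1 := c1) (2 := f).
Qed.

Lemma hessenberg (T : Type) (lt : T -> T -> Prop) : is_cardinal lt -> ~ finite T -> idem T.
Proof.
  intros h inf. apply (hessenberg_step (proj1 h) h inf).
  apply (hessenberg_seg (proj1 h)).
Qed.

(* Regularity of the successor cardinal of |X|, represented by [P]. *)
Lemma regular_bound (T : Type) (lt : T -> T -> Prop) (P : T -> Prop) (X : Type) :
  idem X -> (forall y, P y -> card_le (seg lt y) X) -> ~ card_le {y | P y} X ->
  forall h : X -> T, (forall k, P (h k)) -> exists i, P i /\ forall k, ~ lt i (h k).
Proof.
  (* Without a bound, each [y] in [P] is coded by some [k] with [y] below [h k] and by the image of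
     [y] under an injection of that segment into [X]. *)
  intros iX small big h hP. apply NNPP. intro no. apply big.
  apply card_le_trans with (2 := iX).
  destruct (@func_choice X (T -> X -> Prop) (fun k R =>
     (forall y, lt y (h k) -> exists x, R y x) /\ (forall y y' x, R y x -> R y' x -> y = y')))
    as [R hR].
  { intro k. destruct (small _ (hP k)) as [f hf].
    exists (fun y x => exists l : lt y (h k), f (exist _ y l) = x). split.
    - intros y l. exists (f (exist _ y l)), l; reflexivity.
    - intros y y' x [l e] [l' e'].
      assert (E : exist (fun t => lt t (h k)) y l = exist _ y' l') by (apply hf; congruence).
      injection E; auto. }
  apply card_le_rel with (R := fun y p => lt (proj1_sig y) (h (fst p)) /\
                                 R (fst p) (proj1_sig y) (snd p)).
  - intros [y py]; simpl. destruct (classic (exists k, lt y (h k))) as [[k l]|nk].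
    + destruct (hR k) as [e _]. destruct (e y l) as [x hx]. exists (k, x); auto.
    + destruct no. exists y. split; auto. intros k l. apply nk; eauto.
  - intros [y py] [y' py'] [k x]; simpl. intros [_ r] [_ r'].
    apply sig_eq; simpl. apply (proj2 (hR k)) with x; auto.
Qed.

(** * Successor cardinals *)

Section Successor.
Variables (L : Type) (ltL : L -> L -> Prop) (K : Type) (ltK : K -> K -> Prop).
Hypothesis HL : well_order ltL.
Hypothesis HK : well_order ltK.
Hypothesis Lcard : forall x, ~ card_le L (seg ltL x).
Hypothesis Linf : ~ finite L.
Hypothesis Kseg : forall x, card_le (seg ltK x) L.
Hypothesis Kbig : ~ card_le K L.

Lemma L_idem : idem L.
Proof. apply (@hessenberg L ltL); [split; assumption|exact Linf]. Qed.

Lemma L_not_le_seg_prod x y : ~ card_le L (seg ltL x * seg ltL y).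
Proof.
  assert (main : forall z, ~ card_le L (seg ltL z * seg ltL z)).
  { intros z c. destruct (classic (finite (seg ltL z))) as [f|nf].
    - apply Linf. apply finite_card_le with (1 := c), finite_prod; exact f.
    - apply (Lcard (x := z)). apply card_le_trans with (1 := c).
      apply (hessenberg_seg HL), nf. }
  intro c. destruct (classic (ltL x y)) as [h|h].
  - apply (main y). apply card_le_trans with (1 := c). apply card_le_prod.
    + apply (seg_mono HL). ord HL.
    + apply card_le_refl.
  - apply (main x). apply card_le_trans with (1 := c). apply card_le_prod.
    + apply card_le_refl.
    + apply (seg_mono HL). exact h.
Qed.

Lemma L_inhabited : inhabited L.
Proof. destruct (infinite_nat Linf) as [f _]. constructor; exact (f 0). Qed.

Lemma L_unbounded x : exists y, ltL x y.
Proof.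
  apply NNPP. intro no.
  assert (c : card_le L (option (seg ltL x))).
  { apply card_le_trans with (2 := closed_seg_option HL x).
    exists (fun y => exist (fun y => ~ ltL x y) y (fun h => no (ex_intro _ y h))).
    intros a b e. injection e; auto. }
  destruct (classic (finite (seg ltL x))) as [f|nf].
  - apply Linf. apply finite_card_le with (1 := c), finite_option, f.
  - apply (Lcard (x := x)), card_le_trans with (1 := c), idem_option; auto.
    apply (hessenberg_seg HL), nf.
Qed.

(** Used to refute long sequences: in a set embedded into [L], an increasing [L]-sequence has no
    element [X] of the set above it, as seen by taking for [i] the image of [X]. *)
Lemma L_strict_expansive (h : L -> L) :
  (forall i j, ltL i j -> ltL (h i) (h j)) -> forall i, ~ ltL (h i) i.
Proof.
  intros inc i. induction (wo_wf HL i) as [i _ IH]. intro l.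
  apply (IH (h i) l). apply inc, l.
Qed.

Lemma K_inhabited : inhabited K.
Proof.
  apply NNPP. intro no. apply Kbig. destruct L_inhabited as [l].
  exists (fun _ => l). intros x. destruct no; constructor; exact x.
Qed.

Lemma K_unbounded x : exists y, ltK x y.
Proof.
  apply NNPP. intro no. apply Kbig.
  apply card_le_trans with (option (seg ltK x)).
  { apply card_le_trans with (2 := closed_seg_option HK x).
    exists (fun y => exist (fun y => ~ ltK x y) y (fun h => no (ex_intro _ y h))).
    intros a b e. injection e; auto. }
  apply card_le_trans with (1 := card_le_option (Kseg x)), idem_option, L_idem. exact Linf.
Qed.

Lemma K_bound (X : Type) (h : X -> K) : card_le X L -> exists u, forall k, ltK (h k) u.
Proof.
  intros [f hf]. destruct K_inhabited as [k0].
  destruct (@partial_choice L K (fun l => exists x, f x = l) (fun l k => exists x, f x = l /\ h x = k))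
    as [g hg].
  - constructor; exact k0.
  - intros l [x e]. eauto.
  - destruct (@regular_bound K ltK (fun _ => True) L L_idem) with (h := g) as [i [_ hi]]; auto.
    + intro c. apply Kbig. apply card_le_trans with (2 := c).
      exists (fun k => exist (fun _ => True) k I). intros a b e; injection e; auto.
    + destruct (K_unbounded i) as [u hu]. exists u. intro k.
      destruct (hg (f k)) as [x [e1 e2]]; [eauto|]. apply hf in e1. subst x.
      rewrite e2. specialize (hi (f k)). ord HK.
Qed.

Lemma K_bound_upto (g : K -> K) v : exists u, forall c, ~ ltK v c -> ltK (g c) u.
Proof.
  destruct (@K_bound {c | ~ ltK v c} (fun c => g (proj1_sig c))) as [u hu].
  - apply card_le_trans with (1 := closed_seg_option HK v).
    apply card_le_trans with (1 := card_le_option (Kseg v)), idem_option, L_idem. exact Linf.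
  - exists u. intros c hc. exact (hu (exist _ c hc)).
Qed.

Lemma K_bound_below (Q : L -> Prop) (h : L -> K) : exists u, forall k, Q k -> ltK (h k) u.
Proof.
  destruct (@K_bound L h (card_le_refl L)) as [u hu]. exists u; auto.
Qed.

Lemma L_cube : card_le (L * L * L) L.
Proof.
  apply card_le_trans with (2 := L_idem). apply card_le_prod; [apply L_idem|apply card_le_refl].
Qed.

(** With [gm], one value at [v] controls [g] on everything up to [v], so a limit of points each
    exceeding [gm] of an earlier one is closed under [g]. *)
Lemma monotone_majorant (g : K -> K) :
  exists gm, forall v c, ~ ltK v c -> ltK (g c) (gm v).
Proof. apply (func_choice (fun v u => forall c, ~ ltK v c -> ltK (g c) u)), K_bound_upto. Qed.

Lemma lub_ex (P : K -> Prop) :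
  (exists u, forall p, P p -> ~ ltK u p) ->
  exists u, (forall p, P p -> ~ ltK u p) /\ forall v, (forall p, P p -> ~ ltK v p) -> ~ ltK v u.
Proof. intro ex. exact (wo_least (fun u => forall p, P p -> ~ ltK u p) HK ex). Qed.

(** * Stationary sets and cofinality *)

Definition closed_under (g : K -> K) (a : K) : Prop := forall c, ltK c a -> ltK (g c) a.

(* Every club contains the closure points of some function [K -> K], so it suffices to meet
   these. *)
Definition stationary (S : K -> Prop) : Prop :=
  forall g : K -> K, exists a, S a /\ closed_under g a.

(** The cofinality of [a] exceeds the cardinality of [chi]. Maps on [chi] are total functions on [L]
    of which only the values below [chi] matter. *)
Definition cof_gt (chi : L) (a : K) : Prop :=
  is_limit ltK a /\
  forall h : L -> K, (forall k, ltL k chi -> ltK (h k) a) ->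
    exists u, ltK u a /\ forall k, ltL k chi -> ltK (h k) u.

(** Diagonal intersection in terms of closure points: a value of the two-place function is bounded
    at the larger of its arguments. *)
Lemma closed_under_diag (g : K -> K -> K) :
  exists g', forall a, closed_under g' a -> forall d, ltK d a -> closed_under (g d) a.
Proof.
  destruct (func_choice (fun d gm => forall v c, ~ ltK v c -> ltK (g d c) (gm v)))
    as [gm hgm]; [intro d; apply monotone_majorant|].
  destruct (func_choice (fun v u => forall d, ~ ltK v d -> ltK (gm d v) u)) as [g' hg'].
  { intro v. apply (K_bound_upto (fun d => gm d v)). }
  exists g'. intros a cl d da c ca.
  destruct (wo_tri HK c d) as [h|h].
  - assert (l := hgm d d c). assert (l' := hg' d d). specialize (cl d da).
    assert (ltK (g d c) (gm d d)) by (apply l; ord HK).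
    assert (ltK (gm d d) (g' d)) by (apply l'; ord HK). ord HK.
  - assert (nh : ~ ltK c d) by (destruct h; [subst; ord HK|ord HK]).
    assert (l := hgm d c c). assert (l' := hg' c d nh). specialize (cl c ca).
    assert (ltK (g d c) (gm d c)) by (apply l; ord HK). ord HK.
Qed.

(** The supremum of an increasing sequence of regular length $|\chi|^+$, whose terms grow past the
    values of [gm], has large cofinality and is closed under [g]. *)
Lemma stationary_cof_gt chi : ~ finite (seg ltL chi) -> stationary (cof_gt chi).
Proof.
  intros inf g.
  (* [I] is the initial segment of [L] that represents the cardinal $|\chi|^+$; it may be all of
     [L]. *)
  pose (I := fun y => card_le (seg ltL y) (seg ltL chi)).
  assert (idc := hessenberg_seg HL (x := chi) inf).
  assert (bigI : ~ card_le {y | I y} (seg ltL chi)).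
  { intro c. destruct (classic (exists y, ~ I y)) as [ex|all].
    - destruct (wo_least _ HL ex) as [y [ny min]]. apply ny.
      apply card_le_trans with (2 := c).
      assert (hI : forall z, ltL z y -> I z).
      { intros z l. apply NNPP. intro nz. exact (min z nz l). }
      exists (fun z : seg ltL y => exist I (proj1_sig z) (hI _ (proj2_sig z))).
      intros a b e. apply sig_eq. injection e; auto.
    - apply (Lcard (x := chi)). apply card_le_trans with (2 := c).
      assert (hI : forall z, I z).
      { intros z. apply NNPP. eauto. }
      exists (fun z => exist I z (hI z)). intros a b e. injection e; auto. }
  assert (regI : forall h : seg ltL chi -> L, (forall k, I (h k)) -> exists i, I i /\ forall k, ~ ltL i (h k)).
  { apply regular_bound; auto. }
  assert (downI : forall i j, I j -> ltL i j -> I i).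
  { intros i j hj l. apply card_le_trans with (2 := hj), (seg_mono HL). ord HL. }
  assert (nomaxI : forall i, I i -> exists j, I j /\ ltL i j).
  { intros i hi. apply NNPP. intro no. apply bigI.
    apply card_le_trans with (option (seg ltL i)).
    - apply card_le_trans with (2 := closed_seg_option HL i).
      exists (fun z : {y | I y} => exist (fun y => ~ ltL i y) (proj1_sig z)
                (fun h => no (ex_intro _ _ (conj (proj2_sig z) h)))).
      intros a b e. apply sig_eq. injection e; auto.
    - apply card_le_trans with (1 := card_le_option hi). apply idem_option; auto. }
  assert (Ichi : I chi) by (unfold I; apply card_le_refl).
  destruct (monotone_majorant g) as [gm hgm].
  (* The recursion runs along all of [L], but only terms with index in [I] enter the supremum
     [a]. *)
  destruct (@wf_rec_choice L K ltL
     (fun i d x => forall j, ltL j i -> ltK (d j) x /\ ltK (gm (d j)) x)) as [d hd].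
  { apply K_inhabited. }
  { apply (wo_wf HL). }
  { intros i d. destruct (K_bound_below (fun _ => True) d) as [u hu].
    destruct (K_bound_below (fun _ => True) (fun j => gm (d j))) as [v hv].
    destruct (classic (ltK u v)).
    - exists v. intros j _. specialize (hu j Logic.I). specialize (hv j Logic.I). split; ord HK.
    - exists u. intros j _. specialize (hu j Logic.I). specialize (hv j Logic.I). split; ord HK. }
  { intros i d d' x e h j l. rewrite <- (e j l). auto. }
  destruct (@lub_ex (fun u => exists i, I i /\ u = d i)) as [a [ub lst]].
  { destruct (K_bound_below (fun _ => True) d) as [u hu]. exists u.
    intros p [i [_ ->]]. specialize (hu i Logic.I). ord HK. }
  assert (below : forall i, I i -> ltK (d i) a).
  { intros i hi. destruct (nomaxI i hi) as [j [hj l]].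
    destruct (hd j i l) as [h _]. assert (~ ltK a (d j)) by eauto. ord HK. }
  assert (cofin : forall u, ltK u a -> exists i, I i /\ ltK u (d i)).
  { intros u l. apply NNPP. intro no. apply (lst u); auto.
    intros p [i [hi ->]] h. eauto. }
  exists a. split; [split; [split|]|].
  - exists (d chi). auto.
  - intros u l. destruct (cofin u l) as [i [hi h]]. exists (d i). auto.
  - intros h hh.
    destruct (func_choice (fun (k : seg ltL chi) i => I i /\ ltK (h (proj1_sig k)) (d i)))
      as [f hf].
    { intros [k hk]. apply cofin. simpl. auto. }
    destruct (regI f) as [i [hi bi]]; [intro k; apply hf|].
    destruct (nomaxI i hi) as [j [hj l]].
    exists (d j). split; auto. intros k hk.
    destruct (hf (exist _ k hk)) as [_ h1]. specialize (bi (exist _ k hk)). simpl in h1.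
    destruct (wo_tri HL (f (exist _ k hk)) j) as [t|[t|t]].
    + destruct (hd j _ t). ord HK.
    + rewrite <- t; exact h1.
    + ord HL.
  - intros c l. destruct (cofin c l) as [i [hi h]]. destruct (nomaxI i hi) as [j [hj l']].
    destruct (hd j i l') as [h1 h2]. assert (b := below j hj).
    assert (ltK (g c) (gm (d i))) by (apply hgm; ord HK). ord HK.
Qed.

Lemma limit_infinite (theta : L) : is_limit ltL theta -> ~ finite (seg ltL theta).
Proof.
  intros [[b hb] lim] [l hl].
  assert (max : forall l : list (seg ltL theta), exists m, ltL m theta /\
            forall z, In z l -> ~ ltL m (proj1_sig z)).
  { clear l hl. intro l. induction l as [|z l [m [hm IH]]].
    - exists b. auto.
    - destruct (classic (ltL m (proj1_sig z))) as [h|h].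
      + exists (proj1_sig z). split; [apply (proj2_sig z)|].
        intros y [->|hy]; [ord HL|]. specialize (IH y hy). ord HL.
      + exists m. split; auto. intros y [<-|hy]; auto. }
  destruct (max l) as [m [hm h]]. destruct (lim m hm) as [c [mc ct]].
  exact (h (exist _ c ct) (hl _) mc).
Qed.

(* If [theta] has maps cofinal in [lambda], then [chi] can be taken with more elements than [theta]
   (otherwise [lambda] would be the successor of |theta|, hence regular) and the pigeonhole
   principle applies; in the remaining case take [chi = theta]. *)
Lemma bounded_on_subset (theta : L) : ~ finite (seg ltL theta) ->
  exists chi, ~ finite (seg ltL chi) /\
  forall j : L -> L, exists mu (e : L -> L),
    (forall k, ltL k theta -> ltL (e k) chi) /\
    (forall k k', ltL k k' -> ltL k' theta -> ltL (e k) (e k')) /\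
    (forall k, ltL k theta -> ltL (j (e k)) mu).
Proof.
  intro inf. assert (idt := hessenberg_seg HL (x := theta) inf).
  destruct (classic (forall h : L -> L, exists mu, forall k, ltL k theta -> ltL (h k) mu))
    as [reg|sing].
  { exists theta. split; auto. intro j. destruct (reg j) as [mu hmu].
    exists mu, (fun k => k). auto. }
  apply not_all_ex_not in sing. destruct sing as [h nh].
  assert (cofin : forall mu, exists k, ltL k theta /\ ~ ltL (h k) mu).
  { intro mu. apply NNPP. intro no. apply nh. exists mu. intros k hk. apply NNPP. eauto. }
  assert (exc : exists chi, ~ card_le (seg ltL chi) (seg ltL theta)).
  { apply NNPP. intro no.
    destruct (@regular_bound L ltL (fun _ => True) (seg ltL theta) idt) with
      (h := fun k : seg ltL theta => h (proj1_sig k)) as [i [_ hi]]; auto.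
    - intros y _. apply NNPP. eauto.
    - intro c. apply (Lcard (x := theta)). apply card_le_trans with (2 := c).
      exists (fun z => exist (fun _ => True) z I). intros a b e. injection e; auto.
    - destruct (L_unbounded i) as [i' li]. destruct (cofin i') as [k [hk nk]].
      specialize (hi (exist _ k hk)). simpl in hi. ord HL. }
  destruct exc as [chi hchi]. exists chi. split.
  { intro f. apply hchi. apply card_le_trans with nat; [apply finite_countable, f|].
    apply infinite_nat, inf. }
  intro j.
  (* If each of these sets had at most $|\theta|$ elements, their union [chi] would have at most
     $|\theta|^2=|\theta|$. *)
  assert (pigeon : exists r, ltL r theta /\
            ~ card_le {k | ltL k chi /\ ltL (j k) (h r)} (seg ltL theta)).
  { apply NNPP. intro no. apply hchi. apply card_le_trans with (2 := idt).
    destruct (func_choice (fun (r : seg ltL theta) (F : L -> seg ltL theta -> Prop) =>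
       (forall k, ltL k chi /\ ltL (j k) (h (proj1_sig r)) -> exists z, F k z) /\
       forall k k' z, F k z -> F k' z -> k = k')) as [F hF].
    { intros [r hr].
      assert (c : card_le {k | ltL k chi /\ ltL (j k) (h r)} (seg ltL theta)).
      { apply NNPP. eauto. }
      destruct c as [f hf]. exists (fun k z => exists q, f (exist _ k q) = z). split.
      - intros k q. exists (f (exist _ k q)), q. reflexivity.
      - intros k k' z [q e] [q' e'].
        assert (E := eq_trans e (eq_sym e')). apply hf in E. injection E; auto. }
    apply card_le_rel with (R := fun k p => F (fst p) (proj1_sig k) (snd p)).
    - intros [k hk]. destruct (L_unbounded (j k)) as [mu hmu].
      destruct (cofin mu) as [r [hr nr]].
      destruct (proj1 (hF (exist _ r hr)) k) as [z hz]; [simpl; split; auto; ord HL|].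
      exists (exist _ r hr, z). exact hz.
    - intros a b [r z] e e'. apply sig_eq. apply (proj2 (hF r)) with z; assumption. }
  destruct pigeon as [r [hr big]]. exists (h r).
  pose (Hr := fun k => ltL k chi /\ ltL (j k) (h r)).
  (* [e] lists the first [theta] elements of [Hr] in increasing order; [Hr] is too large to be
     exhausted earlier. *)
  destruct (@wf_rec_choice L L ltL (fun k e x => ltL k theta ->
      (Hr x /\ forall l, ltL l k -> e l <> x) /\
      forall y, (Hr y /\ forall l, ltL l k -> e l <> y) -> ~ ltL y x)) as [e he].
  { apply L_inhabited. }
  { apply (wo_wf HL). }
  { intros k e. destruct (classic (ltL k theta)) as [hk|nk]; [|exists k; contradiction].
    destruct (@wo_least L ltL (fun x => Hr x /\ forall l, ltL l k -> e l <> x) HL) as [x hx].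
    - apply NNPP. intro no. apply big. apply card_le_trans with (seg ltL k).
      + apply card_le_rel with (R := fun (x : {k | Hr k}) l => e (proj1_sig l) = proj1_sig x).
        * intros [x hx]. apply NNPP. intro nl. apply no. exists x. split; auto.
          intros l ll el. apply nl. exists (exist _ l ll). exact el.
        * intros a b l e1 e2. apply sig_eq. congruence.
      + apply (seg_mono HL). ord HL.
    - exists x. intros _. exact hx. }
  { intros k e e' x ee hx hk. destruct (hx hk) as [[h1 h2] h3]. split; [split|]; auto.
    - intros l ll. rewrite <- (ee l ll). auto.
    - intros y [h4 h5]. apply h3. split; auto. intros l ll. rewrite (ee l ll). auto. }
  exists e. split; [|split].
  - intros k hk. destruct (he k hk) as [[[h1 _] _] _]. exact h1.
  - intros k k' l hk'. assert (hk : ltL k theta) by ord HL.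
    destruct (he k hk) as [_ m]. destruct (he k' hk') as [[h1 h2] _].
    assert (ne := h2 k l).
    assert (nl : ~ ltL (e k') (e k)).
    { apply m. split; auto. intros l' ll. apply h2. ord HL. }
    apply NNPP. intro nl'. apply ne. ord HL.
  - intros k hk. destruct (he k hk) as [[[_ h1] _] _]. exact h1.
Qed.

(** * Postprocessing a square sequence *)

(** Total by epsilon, with an arbitrary value on empty predicates. *)
Definition least (P : K -> Prop) : K :=
  epsilon K_inhabited (fun u => P u /\ forall y, P y -> ~ ltK y u).

Lemma least_spec (P : K -> Prop) :
  (exists u, P u) -> P (least P) /\ forall y, P y -> ~ ltK y (least P).
Proof. intro ex. unfold least. apply epsilon_spec, (wo_least P HK ex). Qed.

Lemma least_ext (P Q : K -> Prop) : (forall u, P u <-> Q u) -> least P = least Q.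
Proof.
  intro h. replace Q with P; auto. extensionality u. apply propositional_extensionality, h.
Qed.

Lemma least_unique (P : K -> Prop) u :
  P u -> (forall y, P y -> ~ ltK y u) -> least P = u.
Proof.
  intros hu mu. destruct (least_spec P (ex_intro _ u hu)) as [h1 h2].
  assert (~ ltK u (least P)) by auto. assert (~ ltK (least P) u) by auto. ord HK.
Qed.

(** The supremum of [o] and the earlier values; [o] will be the minimum of the set and serves as the
    value at stage zero. *)
Definition sup_below (o : K) (b : L -> K) (i : L) : K :=
  least (fun u => ~ ltK u o /\ forall j, ltL j i -> ~ ltK u (b j)).

Lemma sup_below_spec o b i :
  ~ ltK (sup_below o b i) o /\ (forall j, ltL j i -> ~ ltK (sup_below o b i) (b j)) /\
  forall v, ~ ltK v o -> (forall j, ltL j i -> ~ ltK v (b j)) -> ~ ltK v (sup_below o b i).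
Proof.
  unfold sup_below.
  destruct (least_spec (fun u => ~ ltK u o /\ forall j, ltL j i -> ~ ltK u (b j)))
    as [[h1 h2] h3].
  - destruct (K_bound_below (fun _ => True) b) as [u hu].
    destruct (classic (ltK u o)) as [l|nl].
    + exists o. split; [ord HK|]. intros j _. specialize (hu j Logic.I). ord HK.
    + exists u. split; auto. intros j _. specialize (hu j Logic.I). ord HK.
  - split; [|split]; auto.
Qed.

Lemma sup_below_ext o b b' i : (forall j, ltL j i -> b j = b' j) -> sup_below o b i = sup_below o b' i.
Proof.
  intro h. apply least_ext. intro u. split; intros [h1 h2]; split; auto; intros j l.
  - rewrite <- (h j l); auto.
  - rewrite (h j l); auto.
Qed.

Lemma accum_limit (A : K -> Prop) b : accum ltK A b -> is_limit ltK b.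
Proof. intros [h1 h2]. split; auto. intros c l. destruct (h2 c l) as [d hd]. exists d. apply hd. Qed.

Lemma accum_mono (A B : K -> Prop) b :
  (forall c, ltK c b -> A c -> B c) -> accum ltK A b -> accum ltK B b.
Proof.
  intros h [h1 h2]. split; auto. intros c l. destruct (h2 c l) as [d [hd [l1 l2]]].
  exists d. auto.
Qed.

Arguments accum_mono A B {b} _ _.

(** * Walking along a set, with one new point below each stop *)

Section Postprocessing.
(* [W o i s b n]: for a set with minimum [o], when the first [i] stages stayed below [s], the
   point [n] may be used at the point [b] of the set. *)
Variable W : K -> L -> K -> K -> K -> Prop.
Hypothesis W_between : forall o i s b n, W o i s b n -> ltK s n /\ ltK n b.

Definition cand (x : K -> Prop) (i : L) (s b : K) : Prop :=
  x b /\ ltK s b /\ exists n, W (least x) i s b n.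

Lemma run_ex : exists b : (K -> Prop) -> L -> K,
  forall x i, b x i = least (cand x i (sup_below (least x) (b x) i)).
Proof.
  apply (func_choice (fun x (b : L -> K) =>
    forall i, b i = least (cand x i (sup_below (least x) b i)))).
  intro x.
  apply (@wf_rec_choice L K ltL (fun i b v => v = least (cand x i (sup_below (least x) b i)))).
  - apply K_inhabited.
  - apply (wo_wf HL).
  - intros i b. eauto.
  - intros i b b' v e h. rewrite (@sup_below_ext (least x) b b' i e) in h. exact h.
Qed.

(** The walk: stage [i] stops at the least candidate above all earlier stops. At a stage without
    candidates the value is arbitrary. *)
Definition run : (K -> Prop) -> L -> K :=
  proj1_sig (constructive_indefinite_description _ run_ex).
Definition run_sup (x : K -> Prop) : L -> K := sup_below (least x) (run x).
(** The choice uses only the minimum, the stage and the stops so far, hence it agrees on sets with a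
    common initial part. *)
Definition new_point (x : K -> Prop) (i : L) : K :=
  epsilon K_inhabited (W (least x) i (run_sup x i) (run x i)).
(** The new points with their limits: the minimum at stage zero, suprema at limits, and at a
    successor stage the preceding new point. The shift by one matches the requirement that element
    $i+1$ lies in $A_i$. *)
Definition new_sup (x : K -> Prop) : L -> K := sup_below (least x) (new_point x).
(** Asking for candidates at the earlier stages too makes the property closed downwards and keeps
    arbitrary values out of the stops so far. *)
Definition alive (x : K -> Prop) (i : L) : Prop :=
  forall j, ~ ltL i j -> exists b, cand x j (run_sup x j) b.

Lemma run_eq x i : run x i = least (cand x i (run_sup x i)).
Proof.
  unfold run_sup, run. destruct (constructive_indefinite_description _ _) as [b hb]. apply hb.
Qed.

Lemma run_alive x i : alive x i ->
  x (run x i) /\ ltK (run_sup x i) (run x i) /\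
  W (least x) i (run_sup x i) (run x i) (new_point x i) /\
  forall b, cand x i (run_sup x i) b -> ~ ltK b (run x i).
Proof.
  intro al. destruct (least_spec (cand x i (run_sup x i))) as [[h1 [h2 h3]] h4].
  - apply al. ord HL.
  - rewrite <- run_eq in *. refine (conj h1 (conj h2 (conj _ h4))).
    unfold new_point. apply epsilon_spec, h3.
Qed.

Lemma alive_down x i j : alive x i -> ~ ltL i j -> alive x j.
Proof. intros al h k hk. apply al. ord HL. Qed.

Arguments alive_down {x i j} _ _.

Lemma run_sup_base x i : ~ ltK (run_sup x i) (least x).
Proof. apply sup_below_spec. Qed.

Lemma new_sup_base x i : ~ ltK (new_sup x i) (least x).
Proof. apply sup_below_spec. Qed.

Lemma run_le_run_sup x i j : ltL j i -> ~ ltK (run_sup x i) (run x j).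
Proof. intro l. unfold run_sup. apply (sup_below_spec (least x) (run x) i), l. Qed.

Lemma new_le_new_sup x i j : ltL j i -> ~ ltK (new_sup x i) (new_point x j).
Proof. intro l. unfold new_sup. apply (sup_below_spec (least x) (new_point x) i), l. Qed.

Lemma new_between x i : alive x i ->
  ltK (run_sup x i) (new_point x i) /\ ltK (new_point x i) (run x i).
Proof. intro al. destruct (run_alive al) as [_ [_ [h _]]]. apply (W_between h). Qed.

Lemma new_sup_le_run_sup x i : (forall j, ltL j i -> alive x j) ->
  ~ ltK (run_sup x i) (new_sup x i).
Proof.
  intro al. unfold new_sup. apply sup_below_spec.
  - apply run_sup_base.
  - intros j l. destruct (new_between (al j l)) as [_ h].
    assert (h' := run_le_run_sup x l). ord HK.
Qed.

Lemma new_sup_lt_new x i : alive x i -> ltK (new_sup x i) (new_point x i).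
Proof.
  intro al. destruct (new_between al) as [h _].
  assert (h' : ~ ltK (run_sup x i) (new_sup x i)).
  { apply new_sup_le_run_sup. intros j l. apply (alive_down al). ord HL. }
  ord HK.
Qed.

Lemma new_sup_incr x i j : ltL i j -> alive x i -> ltK (new_sup x i) (new_sup x j).
Proof.
  intros l al. assert (h := new_sup_lt_new al). assert (h' := new_le_new_sup x l). ord HK.
Qed.

(** Stops and new points interleave, so every new point before stage [i] lies below the new point of
    stage [i]. *)
Lemma new_sup_succ x i j : succ_of ltL i j -> alive x i -> new_sup x j = new_point x i.
Proof.
  intros [l no] al.
  assert (h : ~ ltK (new_point x i) (new_sup x j)).
  { unfold new_sup. apply sup_below_spec.
    - assert (h := run_sup_base x i). destruct (new_between al). ord HK.
    - intros k lk. destruct (wo_tri HL k i) as [t|[t|t]].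
      + destruct (new_between al) as [h1 _].
        assert (alk : alive x k) by (apply (alive_down al); ord HL).
        destruct (new_between alk) as [_ h2].
        assert (h3 := run_le_run_sup x t). ord HK.
      + subst; ord HK.
      + destruct (no k t lk). }
  assert (h' := new_le_new_sup x l). ord HK.
Qed.

Lemma run_incr x i j : ltL i j -> alive x j -> ltK (run x i) (run x j).
Proof.
  intros l al. destruct (run_alive al) as [_ [h _]]. assert (h' := run_le_run_sup x l). ord HK.
Qed.

(** * Walks on a set and on its initial segments *)

Section Locality.
Variables (x x' : K -> Prop) (v : K).
Hypothesis cut : forall c, x' c <-> x c /\ ltK c v.
Hypothesis x'_inh : exists c, x' c.

Lemma least_local : least x' = least x.
Proof.
  destruct x'_inh as [c hc]. destruct (proj1 (cut c) hc) as [xc cv].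
  destruct (least_spec x (ex_intro _ c xc)) as [h1 h2].
  apply least_unique.
  - apply cut. split; auto. specialize (h2 c xc). ord HK.
  - intros y hy. apply h2, cut, hy.
Qed.

Lemma run_sup_local i : (forall j, ltL j i -> run x' j = run x j) -> run_sup x' i = run_sup x i.
Proof.
  intro h. unfold run_sup. rewrite least_local. apply sup_below_ext, h.
Qed.

Lemma cand_local i s b : ltK b v -> (cand x' i s b <-> cand x i s b).
Proof.
  intro l. unfold cand. rewrite least_local, cut. tauto.
Qed.

(** By induction the earlier stops agree. Both sets have the same candidates below [v], and the stop
    of [x'] is one of them, so it is the least candidate in [x] as well. *)
Lemma alive_local_down i : alive x' i -> alive x i /\ run x' i = run x i.
Proof.
  induction (wo_wf HL i) as [i _ IH]. intro al.
  assert (es : run_sup x' i = run_sup x i).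
  { apply run_sup_local. intros j l. apply (IH j l). apply (alive_down al). ord HL. }
  destruct (run_alive al) as [h1 [h2 [h3 h4]]].
  destruct (proj1 (cut _) h1) as [_ lv].
  assert (cd : cand x i (run_sup x i) (run x' i)).
  { rewrite <- es. apply cand_local; auto. split; [|split]; eauto. }
  assert (alx : alive x i).
  { intros j nl. destruct (wo_tri HL j i) as [t|[t|t]].
    - destruct (IH j t (alive_down al nl)) as [h _]. apply h. ord HL.
    - subst j. eauto.
    - contradiction. }
  split; auto. destruct (run_alive alx) as [g1 [g2 [g3 g4]]].
  assert (~ ltK (run x' i) (run x i)) by auto.
  assert (~ ltK (run x i) (run x' i)).
  { intro l. apply (h4 (run x i)); auto. rewrite es. apply cand_local; [ord HK|].
    split; [|split]; eauto. }
  ord HK.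
Qed.

Lemma alive_local_up i : alive x i -> ltK (run x i) v -> alive x' i.
Proof.
  induction (wo_wf HL i) as [i _ IH]. intros al lv j nl.
  assert (IH' : forall k, ltL k i -> alive x' k).
  { intros k l. apply (IH k l).
    - apply (alive_down al). ord HL.
    - assert (h := run_incr l al). ord HK. }
  destruct (wo_tri HL j i) as [t|[t|t]].
  - apply (IH' j t). ord HL.
  - subst j.
    assert (es : run_sup x' i = run_sup x i).
    { apply run_sup_local. intros k l. apply alive_local_down, IH', l. }
    destruct (run_alive al) as [h1 [h2 [h3 _]]].
    exists (run x i). rewrite es. apply cand_local; auto. split; [|split]; eauto.
  - contradiction.
Qed.

Lemma new_point_local i : alive x' i -> new_point x' i = new_point x i.
Proof.
  intro al. unfold new_point. rewrite least_local.
  destruct (alive_local_down al) as [_ ->].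
  rewrite run_sup_local; auto. intros j l. apply alive_local_down, (alive_down al). ord HL.
Qed.

Lemma new_sup_local i : (forall j, ltL j i -> alive x' j) -> new_sup x' i = new_sup x i.
Proof.
  intro al. unfold new_sup. rewrite least_local. apply sup_below_ext.
  intros j l. apply new_point_local; auto.
Qed.
End Locality.

Arguments alive_local_down {x x' v} _ _ {i} _.
Arguments alive_local_up {x x' v} _ _ {i} _ _.
Arguments new_sup_local {x x' v} _ _ {i} _.

(** * The new square sequence *)

Variable C : K -> K -> Prop.
Hypothesis C_square : square_seq ltL ltK C.

Lemma C_below a b : is_limit ltK a -> C a b -> ltK b a.
Proof. intro lim. destruct (C_square lim) as [[h _] _]. apply h. Qed.

Lemma C_closed a b : is_limit ltK a -> ltK b a -> accum ltK (C a) b -> C a b.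
Proof. intro lim. destruct (C_square lim) as [[_ [_ h]] _]. apply h. Qed.

Lemma C_coherent a b : is_limit ltK a -> in_acc ltK (C a) b ->
  forall c, C b c <-> C a c /\ ltK c b.
Proof. intro lim. destruct (C_square lim) as [_ [_ h]]. apply h. Qed.

Definition run_unbounded (a : K) : Prop :=
  forall u, ltK u a -> exists i, alive (C a) i /\ ltK u (run (C a) i).

(* If the run stops early, a tail of [C a] beyond it is kept. *)
Definition post (a c : K) : Prop :=
  (run_unbounded a /\ exists i, alive (C a) i /\ c = new_sup (C a) i) \/
  (~ run_unbounded a /\ C a c /\ forall i, alive (C a) i -> ltK (run (C a) i) c).

Lemma post_main a c : run_unbounded a ->
  (post a c <-> exists i, alive (C a) i /\ c = new_sup (C a) i).
Proof. unfold post. tauto. Qed.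

Lemma post_tail a c : ~ run_unbounded a ->
  (post a c <-> C a c /\ forall i, alive (C a) i -> ltK (run (C a) i) c).
Proof. unfold post. tauto. Qed.

Lemma run_lt a i : is_limit ltK a -> alive (C a) i -> ltK (run (C a) i) a.
Proof. intros lim al. apply C_below, (run_alive al). exact lim. Qed.

Lemma new_sup_lt_run x i : alive x i -> ltK (new_sup x i) (run x i).
Proof.
  intro al. assert (h := new_sup_lt_new al). destruct (new_between al). ord HK.
Qed.

(** Three stops at stages $i<j<k$ above [u] suffice: the new point of stage [j] is above the stop of
    stage [i], and [new_sup] at [k] is at least that new point. *)
Lemma run_unbounded_new_sup a : is_limit ltK a -> run_unbounded a ->
  forall u, ltK u a -> exists i, alive (C a) i /\ ltK u (new_sup (C a) i).
Proof.
  intros lim main u l. destruct (main u l) as [i [ali li]].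
  destruct (main _ (run_lt lim ali)) as [j [alj lj]].
  destruct (main _ (run_lt lim alj)) as [k [alk lk]].
  assert (ij : ltL i j).
  { apply NNPP. intro n. destruct (wo_tri HL i j) as [t|[<-|t]]; [contradiction|ord HK|].
    assert (h := run_incr t ali). ord HK. }
  assert (jk : ltL j k).
  { apply NNPP. intro n. destruct (wo_tri HL j k) as [t|[<-|t]]; [contradiction|ord HK|].
    assert (h := run_incr t alj). ord HK. }
  exists k. split; auto.
  assert (h1 := new_le_new_sup (C a) jk). destruct (new_between alj) as [h2 _].
  assert (h3 := run_le_run_sup (C a) ij). ord HK.
Qed.

Lemma post_lt a c : is_limit ltK a -> post a c -> ltK c a.
Proof.
  intros lim [[_ [i [al ->]]]|[_ [h _]]].
  - assert (h := new_sup_lt_run al). assert (h' := run_lt lim al). ord HK.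
  - apply C_below; auto.
Qed.

(** Accumulation forces [i] to be a limit, so some stage [j1] lies between [j] and [i], and its new
    point is above the stop [run x j]. *)
Lemma new_sup_accum x i :
  accum ltK (fun c => exists j, alive x j /\ c = new_sup x j) (new_sup x i) ->
  alive x i -> forall j, ltL j i -> ltK (run x j) (new_sup x i).
Proof.
  intros [_ ac] al j l.
  assert (step : forall k, ltL k i -> exists k', ltL k' i /\ ltL k k').
  { intros k lk. destruct (ac (new_sup x k)) as [d [[k' [alk' ->]] [l1 l2]]].
    - apply new_sup_incr; auto. apply (alive_down al). ord HL.
    - exists k'. split.
      + apply NNPP. intro n. destruct (wo_tri HL k' i) as [t|[->|t]]; [contradiction|ord HK|].
        assert (h := new_sup_incr t al). ord HK.
      + apply NNPP. intro n. destruct (wo_tri HL k k') as [t|[->|t]]; [contradiction|ord HK|].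
        assert (h := new_sup_incr t alk'). ord HK. }
  destruct (step j l) as [j1 [l1 m1]].
  assert (al1 : alive x j1) by (apply (alive_down al); ord HL).
  destruct (new_between al1) as [h1 _].
  assert (h2 := new_le_new_sup x l1). assert (h3 := run_le_run_sup x m1). ord HK.
Qed.

(* A limit of new points is a limit of the run, hence a limit point of [C a]. *)
Lemma run_limit_acc a v (len : L) : is_limit ltK a -> ltK v a ->
  (exists j, ltL j len) -> (forall i, ltL i len -> alive (C a) i /\ ltK (run (C a) i) v) ->
  (forall w, ltK w v -> exists j, ltL j len /\ ltK w (run (C a) j)) ->
  in_acc ltK (C a) v /\
  (forall i, alive (C v) i <-> ltL i len) /\ run_unbounded v /\
  (forall i, ltL i len -> new_sup (C v) i = new_sup (C a) i).
Proof.
  intros lim va [j0 hj0] below cofin.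
  assert (ac : accum ltK (C a) v).
  { split.
    - destruct (below j0 hj0). eauto.
    - intros w lw. destruct (cofin w lw) as [j [lj wj]].
      destruct (below j lj) as [al lv]. exists (run (C a) j). split; auto. apply (run_alive al). }
  assert (Cav : C a v) by (apply C_closed; assumption).
  assert (cut : forall c, C v c <-> C a c /\ ltK c v).
  { apply C_coherent; auto. split; assumption. }
  assert (inh : exists c, C v c).
  { destruct (below j0 hj0) as [al lv]. exists (run (C a) j0). apply cut. split; auto.
    apply (run_alive al). }
  assert (aliff : forall i, alive (C v) i <-> ltL i len).
  { intro i. split.
    - intro al. apply NNPP. intro nl.
      destruct (alive_local_down cut inh al) as [ala er].
      destruct (run_alive al) as [h _]. apply cut in h. destruct h as [_ h].
      rewrite er in h. destruct (cofin _ h) as [j [lj lr]].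
      assert (ltL j i) by ord HL. assert (h' := run_incr H ala). ord HK.
    - intro l. destruct (below i l). apply (alive_local_up cut inh); auto. }
  split; [split; assumption|]. split; [exact aliff|]. split.
  - intros u l. destruct (cofin u l) as [j [lj uj]]. exists j.
    assert (al := proj2 (aliff j) lj). split; auto.
    destruct (alive_local_down cut inh al) as [_ ->]. exact uj.
  - intros i l. apply (new_sup_local cut inh). intros j lj. apply aliff. ord HL.
Qed.

Lemma otp_le_sub (A B : K -> Prop) : (forall c, A c -> B c) -> otp_le ltL ltK B -> otp_le ltL ltK A.
Proof. intros h [f hf]. exists f. auto. Qed.

Lemma post_main_club a : is_limit ltK a -> run_unbounded a -> club_in ltK (post a) a.
Proof.
  intros lim main. split; [|split].
  - intros b. apply post_lt, lim.
  - intros b l. destruct (run_unbounded_new_sup lim main l) as [i [al h]].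
    exists (new_sup (C a) i). split; auto. apply (post_main _ main). eauto.
  - intros v lv ac. apply (post_main _ main).
    apply (accum_mono (post a) (fun c => exists i, alive (C a) i /\ c = new_sup (C a) i)) in ac.
    2:{ intros c _. apply (post_main _ main). }
    destruct (run_unbounded_new_sup lim main lv) as [i0 [al0 h0]].
    (* The index of a limit [v] is the first [i] at which [new_sup] has reached [v]. *)
    destruct (@wo_least L ltL (fun i => ~ ltK (new_sup (C a) i) v) HL) as [i [hi mini]].
    { exists i0. ord HK. }
    assert (ali : alive (C a) i).
    { apply (alive_down al0). apply mini. ord HK. }
    exists i. split; auto. destruct ac as [[c0 l0] ac].
    enough (~ ltK v (new_sup (C a) i)) by ord HK.
    unfold new_sup at 1. apply sup_below_spec.
    + destruct (ac c0 l0) as [d [[j [_ ->]] [l1 l2]]].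
      assert (h := new_sup_base (C a) j). ord HK.
    + intros j lj.
      assert (lv' : ltK (new_sup (C a) j) v).
      { apply NNPP. intro n. exact (mini j n lj). }
      destruct (ac _ lv') as [d [[k [alk ->]] [l1 l2]]].
      assert (jk : ltL j k).
      { apply NNPP. intro n. destruct (wo_tri HL j k) as [t|[->|t]]; [contradiction|ord HK|].
        assert (h := new_sup_incr t alk). ord HK. }
      assert (h := new_le_new_sup (C a) jk). ord HK.
Qed.

(** The point [v] is a limit of stops, so coherence of [C] and locality turn the walk on [C v] into
    the first stages of the walk on [C a]. *)
Lemma post_main_coherent a v : is_limit ltK a -> run_unbounded a -> in_acc ltK (post a) v ->
  forall c, post v c <-> (post a c /\ ltK c v).
Proof.
  intros lim main [pv ac].
  assert (va := post_lt lim pv). apply (post_main _ main) in pv. destruct pv as [i [al ->]].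
  apply (accum_mono (post a) (fun c => exists i, alive (C a) i /\ c = new_sup (C a) i)) in ac.
  2:{ intros c _. apply (post_main _ main). }
  assert (below := new_sup_accum ac al). destruct ac as [[c0 l0] ac].
  assert (idx : forall j, alive (C a) j -> ltK (new_sup (C a) j) (new_sup (C a) i) -> ltL j i).
  { intros j alj l. apply NNPP. intro n.
    destruct (wo_tri HL j i) as [t|[->|t]]; [contradiction|ord HK|].
    assert (h := new_sup_incr t al). ord HK. }
  destruct (@run_limit_acc a (new_sup (C a) i) i lim va) as [_ [aliff [mainv same]]].
  - destruct (ac c0 l0) as [d [[j [alj ->]] [l1 l2]]]. eauto.
  - intros j l. split; auto. apply (alive_down al). ord HL.
  - intros w lw. destruct (ac w lw) as [d [[j [alj ->]] [l1 l2]]].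
    exists j. split; auto. assert (h := new_sup_lt_run alj). ord HK.
  - intro c. rewrite (post_main _ mainv), (post_main _ main). split.
    + intros [j [alj ->]]. apply aliff in alj. rewrite same; auto.
      assert (alj' : alive (C a) j) by (apply (alive_down al); ord HL).
      split; eauto. apply new_sup_incr; auto.
    + intros [[j [alj ->]] l]. assert (ji := idx j alj l). exists j. split.
      * apply aliff, ji.
      * symmetry; apply same, ji.
Qed.

Lemma post_tail_bound a : is_limit ltK a -> ~ run_unbounded a ->
  exists u, ltK u a /\ forall i, alive (C a) i -> ~ ltK u (run (C a) i).
Proof.
  intros lim nm. apply NNPP. intro no. apply nm. intros u l. apply NNPP. intro no'.
  apply no. exists u. split; auto. intros i al h. eauto.
Qed.

Lemma post_tail_club a : is_limit ltK a -> ~ run_unbounded a -> club_in ltK (post a) a.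
Proof.
  intros lim nm. destruct (C_square lim) as [[cl1 [cl2 cl3]] _].
  destruct (post_tail_bound lim nm) as [u [lu hu]].
  split; [|split].
  - intros b. apply post_lt, lim.
  - intros b l.
    assert (ex : exists w, ltK w a /\ ~ ltK w b /\ ~ ltK w u).
    { destruct (classic (ltK b u)); [exists u|exists b]; repeat split; ord HK. }
    destruct ex as [w [lw [wb wu]]]. destruct (cl2 w lw) as [d [hd ld]].
    exists d. split; [|ord HK]. apply (post_tail _ nm). split; auto.
    intros i al. assert (h := hu i al). ord HK.
  - intros v lv ac. apply (post_tail _ nm). split.
    + apply cl3; auto. apply (accum_mono (post a) _); auto.
      intros c _ h. apply (post_tail _ nm), h.
    + intros i al. destruct ac as [[c0 l0] ac]. destruct (ac c0 l0) as [d [hd [l1 l2]]].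
      apply (post_tail _ nm) in hd. destruct hd as [_ hd]. specialize (hd i al). ord HK.
Qed.

(** Some point of [post a] below [v] is above all stops, so the walks on [C v] and [C a] have the
    same alive stages and stops, and neither is unbounded. *)
Lemma post_tail_coherent a v : is_limit ltK a -> ~ run_unbounded a -> in_acc ltK (post a) v ->
  forall c, post v c <-> (post a c /\ ltK c v).
Proof.
  intros lim nm [pv ac]. assert (va := post_lt lim pv).
  apply (post_tail _ nm) in pv. destruct pv as [Cav hv].
  assert (ac' : accum ltK (C a) v).
  { apply (accum_mono (post a) _); auto. intros c _ h. apply (post_tail _ nm), h. }
  assert (cut : forall c, C v c <-> C a c /\ ltK c v) by (apply C_coherent; auto; split; assumption).
  destruct ac as [[c0 l0] ac]. destruct (ac c0 l0) as [d [hd [l1 l2]]].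
  assert (hd' := hd). apply (post_tail _ nm) in hd'. destruct hd' as [Cad hd'].
  assert (inh : exists c, C v c) by (exists d; apply cut; auto).
  assert (aliff : forall i, alive (C v) i <-> alive (C a) i).
  { intro i. split.
    - intro al. apply (alive_local_down cut inh al).
    - intro al. apply (alive_local_up cut inh); auto. }
  assert (same : forall i, alive (C a) i -> run (C v) i = run (C a) i).
  { intros i al. apply (alive_local_down cut inh), aliff, al. }
  assert (nmv : ~ run_unbounded v).
  { intro main. destruct (main d l2) as [i [al l]]. apply aliff in al. rewrite same in l; auto.
    specialize (hd' i al). ord HK. }
  intro c. rewrite (post_tail _ nmv), (post_tail _ nm), cut. split.
  - intros [[h1 h2] h3]. split; auto. split; auto. intros i al. rewrite <- same; auto.
    apply h3, aliff, al.
  - intros [[h1 h3] h2]. split; auto. intros i al. apply aliff in al. rewrite same; auto.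
Qed.

Lemma post_otp a : is_limit ltK a -> otp_le ltL ltK (post a).
Proof.
  intro lim. destruct (classic (run_unbounded a)) as [main|nm].
  - destruct (@partial_choice K L (post a) (fun c i => alive (C a) i /\ c = new_sup (C a) i))
      as [f hf].
    + apply L_inhabited.
    + intro c. apply (post_main _ main).
    + exists f. intros b c hb hc l. destruct (hf b hb) as [al e]. destruct (hf c hc) as [al' e'].
      apply NNPP. intro n. destruct (wo_tri HL (f b) (f c)) as [t|[t|t]]; [contradiction| |].
      * rewrite t in e. rewrite <- e' in e. subst. ord HK.
      * assert (h := new_sup_incr t al'). rewrite <- e, <- e' in h. ord HK.
  - apply otp_le_sub with (C a); [|apply (C_square lim)].
    intros c h. apply (post_tail _ nm), h.
Qed.

Lemma post_square : square_seq ltL ltK post.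
Proof.
  intros a lim. split; [|split].
  - destruct (classic (run_unbounded a)); [apply post_main_club|apply post_tail_club]; auto.
  - apply post_otp, lim.
  - intros b hb. destruct (classic (run_unbounded a));
      [apply post_main_coherent|apply post_tail_coherent]; auto.
Qed.

(** Cut at [v], the supremum of the first [theta] stops. It is at most [X], hence below [a], and is
    a limit point of [C a], so exactly [theta] stages survive on [C v]. *)
Lemma post_enumerates a theta X : is_limit ltK a -> is_limit ltL theta -> ltK X a ->
  (forall i, ltL i theta -> alive (C a) i /\ ~ ltK X (run (C a) i)) ->
  exists v, is_limit ltK v /\ enumerates ltL ltK (post v) theta (new_sup (C a)).
Proof.
  intros lim [[j0 hj0] limt] lX below.
  set (v := run_sup (C a) theta).
  assert (vX : ~ ltK X v).
  { unfold v, run_sup. apply sup_below_spec.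
    - destruct (below j0 hj0) as [al h]. assert (h1 := run_sup_base (C a) j0).
      destruct (run_alive al) as [_ [h2 _]]. ord HK.
    - intros j l. apply below, l. }
  assert (cofin : forall w, ltK w v -> exists j, ltL j theta /\ ltK w (run (C a) j)).
  { intros w lw. apply NNPP. intro no.
    enough (~ ltK w v) by contradiction.
    unfold v, run_sup. apply sup_below_spec.
    - intro h. apply no. exists j0. split; auto. destruct (below j0 hj0) as [al _].
      assert (h1 := run_sup_base (C a) j0). destruct (run_alive al) as [_ [h2 _]]. ord HK.
    - intros j l h. eauto. }
  destruct (@run_limit_acc a v theta lim) as [[_ ac] [aliff [main same]]]; auto.
  - ord HK.
  - eauto.
  - intros i l. split; [apply below, l|]. destruct (limt i l) as [j [ij jt]].
    destruct (below j jt) as [al _]. assert (h := run_incr ij al).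
    assert (h' := run_le_run_sup (C a) jt). fold v in h'. ord HK.
  - exists v. split; [apply accum_limit with (1 := ac)|]. split.
    + intros i j ij jt. apply new_sup_incr; auto. apply below. ord HL.
    + intro b. rewrite (post_main _ main). split.
      * intros [i [al ->]]. apply aliff in al. exists i. rewrite same; auto.
      * intros [i [l <-]]. exists i. split; [apply aliff, l|]. symmetry; apply same, l.
Qed.
End Postprocessing.

(** The parameter is consulted only at the minimum of the set; this lets parameters for different
    [theta] be merged into one. *)
Lemma run_param (W W' : K -> L -> K -> K -> K -> Prop) (x : K -> Prop) :
  W (least x) = W' (least x) ->
  (forall i, run W x i = run W' x i) /\ (forall i, run_sup W x i = run_sup W' x i) /\
  (forall i, new_point W x i = new_point W' x i) /\ (forall i, alive W x i <-> alive W' x i).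
Proof.
  intro h.
  assert (ec : cand W x = cand W' x) by (unfold cand; rewrite h; reflexivity).
  assert (er : forall i, run W x i = run W' x i).
  { intro i. induction (wo_wf HL i) as [i _ IH]. rewrite !run_eq, ec.
    unfold run_sup. rewrite (sup_below_ext _ _ _ IH). reflexivity. }
  assert (es : forall i, run_sup W x i = run_sup W' x i).
  { intro i. apply sup_below_ext. auto. }
  refine (conj er (conj es (conj _ _))); intro i.
  - unfold new_point. rewrite h, er, es. reflexivity.
  - unfold alive. rewrite ec. split; intros al j l; [rewrite <- es|rewrite es]; auto.
Qed.

(** * Stationary sets indexed by the minimum of [C a] *)

Lemma dominate2 (g1 g2 : K -> K) : exists g, forall v, ltK (g1 v) (g v) /\ ltK (g2 v) (g v).
Proof.
  apply (func_choice (fun v u => ltK (g1 v) u /\ ltK (g2 v) u)). intro v.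
  destruct (K_unbounded (g1 v)) as [u hu]. destruct (K_unbounded (g2 v)) as [w hw].
  destruct (classic (ltK u w)); [exists w|exists u]; split; ord HK.
Qed.

Lemma closed_under_le (g g' : K -> K) a :
  (forall v, ltK (g v) (g' v)) -> closed_under g' a -> closed_under g a.
Proof. intros h cl c l. assert (h' := h c). specialize (cl c l). ord HK. Qed.

Lemma stationary_closed_above (S : K -> Prop) : stationary S ->
  (forall a, S a -> is_limit ltK a) ->
  forall g u, exists a, S a /\ closed_under g a /\ ltK u a.
Proof.
  intros st lim g u. destruct (dominate2 g (fun _ => u)) as [g' hg'].
  destruct (st g') as [a [hS cl]]. exists a. split; auto. split.
  - apply closed_under_le with (2 := cl). apply hg'.
  - destruct (lim a hS) as [[b hb] _]. specialize (cl b hb). destruct (hg' b). ord HK.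
Qed.

(** Otherwise each [eps] has a bound such that, for [a] in [S] closed under some function, [C a] has
    a point between [eps] and the bound. If [a] is closed under the diagonal of these functions,
    [C a] contains every limit point below [a] that is closed under [q], and these can be too
    many. *)
Lemma square_min_unbounded (C : K -> K -> Prop) (S : K -> Prop) :
  square_seq ltL ltK C -> stationary S -> (forall a, S a -> is_limit ltK a) ->
  exists eps, forall zeta,
    stationary (fun a => S a /\ forall c, C a c -> ~ ltK c eps -> ltK zeta c).
Proof.
  intros sq st lim. apply NNPP. intro no.
  destruct (func_choice (fun eps (p : K * (K -> K)) => forall a, S a -> closed_under (snd p) a ->
     exists c, C a c /\ ~ ltK c eps /\ ~ ltK (fst p) c)) as [p hp].
  { intro eps. apply NNPP. intro no'. apply no. exists eps. intros zeta g.
    apply NNPP. intro no2. apply no'. exists (zeta, g). simpl. intros a hS cl.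
    apply NNPP. intro no3. apply no2. exists a. split; [split|]; auto.
    intros c h1 h2. apply NNPP. intro h3. eauto. }
  destruct (func_choice (fun u v => ltK u v) K_unbounded) as [sK hsK].
  destruct (dominate2 sK (fun u => fst (p (sK u)))) as [q hq].
  destruct (closed_under_diag (fun eps => snd (p eps))) as [g' hg'].
  (* An increasing [L]-sequence of points closed under [q], and one more such point [top] above it,
     contradict order type at most $\lambda$. *)
  destruct (@wf_rec_choice L K ltL (fun i d x =>
     (is_limit ltK x /\ closed_under q x) /\ forall j, ltL j i -> ltK (d j) x)) as [d hd].
  { apply K_inhabited. }
  { apply (wo_wf HL). }
  { intros i d. destruct (K_bound_below (fun _ => True) d) as [u hu].
    destruct (stationary_closed_above st lim q u) as [x [h1 [h2 h3]]].
    exists x. split; [split|]; auto. intros j _. specialize (hu j Logic.I). ord HK. }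
  { intros i d d' x e [h1 h2]. split; auto. intros j l. rewrite <- (e j l). auto. }
  destruct (K_bound_below (fun _ => True) d) as [u hu].
  destruct (stationary_closed_above st lim q u) as [top [ht1 [ht2 ht3]]].
  destruct (stationary_closed_above st lim g' top) as [a [ha1 [ha2 ha3]]].
  assert (inC : forall v, is_limit ltK v -> closed_under q v -> ltK v a -> C a v).
  { intros v [[b hb] _] cl va. apply (C_closed sq); auto. split; [eauto|].
    intros w wv. assert (l := cl w wv). destruct (hq w) as [l1 l2]. assert (l3 := hsK w).
    destruct (hp (sK w) a ha1) as [c [c1 [c2 c3]]].
    - apply hg'; auto. ord HK.
    - exists c. split; auto. split; ord HK. }
  destruct (sq a (lim a ha1)) as [_ [[f hf] _]].
  assert (dtop : forall i, ltK (d i) top) by (intro i; specialize (hu i Logic.I); ord HK).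
  assert (Cd : forall i, C a (d i)).
  { intro i. destruct (hd i) as [[h1 h2] _]. apply inC; auto. specialize (dtop i). ord HK. }
  apply (L_strict_expansive (fun i => f (d i))) with (i := f top).
  - intros i j l. apply hf; auto. apply (hd j), l.
  - apply hf; auto.
Qed.

(** Every [C a] with [a] above a common [eps] loses its points below [eps]. For each relevant
    [theta], pressing down gives a minimum [d theta] attained on a stationary set; these are chosen
    distinct, and [code] inverts [d]. *)
Lemma coherent_codes (C : K -> K -> Prop) (chi : L -> L) : square_seq ltL ltK C ->
  exists (C' : K -> K -> Prop) (code : K -> L), square_seq ltL ltK C' /\
    forall theta, ~ finite (seg ltL (chi theta)) ->
      stationary (fun a => cof_gt (chi theta) a /\ code (least (C' a)) = theta).
Proof.
  intro sq.
  destruct (@partial_choice L K (fun theta => ~ finite (seg ltL (chi theta)))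
    (fun theta eps => forall zeta, stationary (fun a => cof_gt (chi theta) a /\
        forall c, C a c -> ~ ltK c eps -> ltK zeta c))) as [epsf hepsf].
  { apply K_inhabited. }
  { intros theta inf. apply square_min_unbounded; auto.
    - apply stationary_cof_gt, inf.
    - intros a h. apply h. }
  destruct (K_bound_below (fun _ => True) epsf) as [eps heps].
  pose (minat := fun d a => C a d /\ ~ ltK d eps /\ forall c, C a c -> ~ ltK c eps -> ~ ltK c d).
  (* Pressing down: if each [d] were refuted by a function [g d], a point [a] closed under the
     diagonal function would contradict this for the minimum of its own cut set. *)
  assert (step : forall theta zeta, ~ finite (seg ltL (chi theta)) -> exists d, ltK zeta d /\
     stationary (fun a => cof_gt (chi theta) a /\ ltK eps a /\ minat d a)).
  { intros theta zeta inf. apply NNPP. intro no.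
    destruct (func_choice (fun d g => ltK zeta d -> forall a, cof_gt (chi theta) a ->
        ltK eps a -> minat d a -> ~ closed_under g a)) as [g hg].
    { intro d. apply NNPP. intro no'. apply no. exists d. split.
      - apply NNPP. intro h. apply no'. exists (fun v => v). intro; contradiction.
      - intro g. apply NNPP. intro no2. apply no'. exists g. intros _ a h1 h2 h3 h4.
        apply no2. exists a. auto. }
    destruct (closed_under_diag g) as [g' hg'].
    destruct (@stationary_closed_above (fun a => cof_gt (chi theta) a /\
        forall c, C a c -> ~ ltK c (epsf theta) -> ltK zeta c)) with (g := g') (u := eps)
      as [a [[h1 h2] [h3 h4]]].
    - apply hepsf, inf.
    - intros a h. apply h.
    - destruct (sq a (proj1 h1)) as [[cl1 [cl2 _]] _].
      destruct (least_spec (fun c => C a c /\ ~ ltK c eps)) as [[m1 m2] m3].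
      { destruct (cl2 eps h4) as [c [hc l]]. exists c. split; auto. ord HK. }
      set (d := least _) in *.
      apply (hg d) with (a := a); auto.
      + apply h2; auto. specialize (heps theta Logic.I). ord HK.
      + split; [|split]; auto. }
  destruct (@wf_rec_choice L K ltL (fun theta d x => (forall t, ltL t theta -> ltK (d t) x) /\
     (~ finite (seg ltL (chi theta)) ->
      stationary (fun a => cof_gt (chi theta) a /\ ltK eps a /\ minat x a)))) as [d hd].
  { apply K_inhabited. }
  { apply (wo_wf HL). }
  { intros theta d. destruct (K_bound_below (fun _ => True) d) as [u hu].
    destruct (classic (finite (seg ltL (chi theta)))) as [fin|inf].
    - exists u. split; [intros t _; apply (hu t Logic.I)|]. intro; contradiction.
    - destruct (step theta u inf) as [x [h1 h2]]. exists x. split; auto.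
      intros t _. specialize (hu t Logic.I). ord HK. }
  { intros theta d d' x e [h1 h2]. split; auto. intros t l. rewrite <- (e t l); auto. }
  assert (dinj : forall t t', d t = d t' -> t = t').
  { intros t t' e. destruct (wo_tri HL t t') as [h|[h|h]]; auto.
    - apply (hd t') in h. rewrite e in h. ord HK.
    - apply (hd t) in h. rewrite e in h. ord HK. }
  exists (fun a c => C a c /\ (ltK eps a -> ~ ltK c eps)),
         (fun u => epsilon L_inhabited (fun t => d t = u)).
  split.
  - intros a lim. destruct (sq a lim) as [[cl1 [cl2 cl3]] [ot co]].
    split; [split; [|split]|split].
    + intros b [h _]; auto.
    + intros b l. destruct (classic (ltK eps a)) as [ea|na].
      * destruct (classic (ltK b eps)).
        -- destruct (cl2 eps ea) as [c [hc lc]]. exists c. split; [split|]; auto; [intro|]; ord HK.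
        -- destruct (cl2 b l) as [c [hc lc]]. exists c. split; [split|]; auto. intro; ord HK.
      * destruct (cl2 b l) as [c [hc lc]]. exists c. split; [split|]; auto; contradiction.
    + intros b l ac. split.
      * apply cl3; auto. apply (accum_mono (fun c => C a c /\ (ltK eps a -> ~ ltK c eps)) (C a)); auto.
        intros c _ h; apply h.
      * intro ea. destruct ac as [[c0 l0] ac]. destruct (ac c0 l0) as [c [[_ h1] [h2 h3]]].
        specialize (h1 ea). ord HK.
    + apply otp_le_sub with (C a); auto. intros c h; apply h.
    + intros b [[h1 h2] ac] c.
      assert (acC : in_acc ltK (C a) b).
      { split; auto. apply (accum_mono (fun c => C a c /\ (ltK eps a -> ~ ltK c eps)) (C a)); auto.
        intros c' _ h; apply h. }
      specialize (co b acC c).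
      (* Cut and uncut sets do not mix: an accumulation point of a cut set lies above [eps]. *)
      assert (eq : ltK eps b <-> ltK eps a).
      { specialize (cl1 b h1). split; intro h; [ord HK|].
        destruct ac as [[c0 l0] ac]. destruct (ac c0 l0) as [e [[_ k1] [k2 k3]]].
        specialize (k1 h). ord HK. }
      tauto.
  - intros theta inf g. destruct (proj2 (hd theta) inf g) as [a [[h1 [h2 [h3 [h4 h5]]]] h6]].
    exists a. split; [split|]; auto.
    rewrite (@least_unique (fun c => C a c /\ (ltK eps a -> ~ ltK c eps)) (d theta)).
    + apply dinj. apply epsilon_spec with (P := fun t => d t = d theta). eauto.
    + auto.
    + intros c [k1 k2]. apply h5; auto.
Qed.

(** * Guessing *)

Section Guessing.
Variable G : K -> option (L * L * L) -> K.
Hypothesis G_onto : forall F, exists xi, G xi = F.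
Variable idx : K -> K -> L.
Hypothesis idx_inj : forall b x y, ltK x b -> ltK y b -> idx b x = idx b y -> x = y.

Let data : Type := ((L -> K -> Prop) * (K -> Prop))%type.

(** Choosing the correct point once and for all lets a conjecture be compared with it by
    equality. *)
Definition next (z : data) (g : K) (i : L) : K :=
  epsilon K_inhabited (fun a => fst z i a /\ exists d, snd z d /\ ltK g d /\ ltK d a).

Lemma next_spec (z : data) g i : (forall i, unbounded ltK (fst z i)) -> club ltK (snd z) ->
  fst z i (next z g i) /\ exists d, snd z d /\ ltK g d /\ ltK d (next z g i).
Proof.
  intros ub [cl _]. unfold next. apply epsilon_spec.
  destruct (cl g) as [d [h1 h2]]. destruct (ub i d) as [a [h3 h4]]. exists a. eauto.
Qed.

(* The ordinal [xi] codes the pair of an ordinal [G xi None] and a conjecture about the values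
   [next (z e) (G xi None) j]; it is believed if it is right for all [e] below [tau]. *)
Definition guess (mu tau : L) (z : L -> data) (o : K) (i : L) (s b n : K) : Prop :=
  (ltK s n /\ ltK n b) /\
  exists xi, ltK xi b /\ ltL (idx b xi) mu /\ ~ ltK (G xi None) s /\
    (forall e, ltL e tau -> forall j, G xi (Some (mu, e, j)) = next (z e) (G xi None) j) /\
    n = G xi (Some (mu, tau, i)).

Lemma guess_ext mu tau z z' : (forall e, ltL e tau -> z e = z' e) ->
  guess mu tau z = guess mu tau z'.
Proof.
  intro h. unfold guess. extensionality o. extensionality i. extensionality s.
  extensionality b. extensionality n. apply propositional_extensionality.
  split; intros [h0 [xi [h1 [h2 [h3 [h4 h5]]]]]]; split; auto; exists xi;
    repeat (split; auto); intros e l j.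
  - rewrite <- (h e l). auto.
  - rewrite (h e l). auto.
Qed.

(* The supremum of an omega-sequence in [C a] stays below [a] because [chi] is infinite. *)
Lemma closed_points (C : K -> K -> Prop) chi g gm a :
  square_seq ltL ltK C -> ~ finite (seg ltL chi) -> cof_gt chi a ->
  (forall v c, ~ ltK v c -> ltK (g c) (gm v)) -> closed_under gm a ->
  forall u, ltK u a -> exists v, C a v /\ ltK u v /\ ltK v a /\ closed_under g v.
Proof.
  intros sq inf [lim cof] hgm cl u ua.
  destruct (sq a lim) as [[cl1 [cl2 cl3]] _].
  destruct (@partial_choice K K (fun v => ltK v a) (fun v w => C a w /\ ltK v w /\ ltK (gm v) w))
    as [st hst].
  { apply K_inhabited. }
  { intros v va. assert (l := cl v va).
    assert (ex : exists w, ltK w a /\ ~ ltK w v /\ ~ ltK w (gm v)).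
    { destruct (classic (ltK v (gm v))); [exists (gm v)|exists v]; repeat split; ord HK. }
    destruct ex as [w [wa [wv wg]]]. destruct (cl2 w wa) as [d [hd ld]].
    exists d. split; auto. split; ord HK. }
  pose (u_ := fun n => Nat.iter n st u).
  assert (below : forall n, ltK (u_ n) a).
  { induction n as [|n IH]; [exact ua|]. apply cl1. simpl. apply hst, IH. }
  assert (up : forall n, C a (u_ (S n)) /\ ltK (u_ n) (u_ (S n)) /\ ltK (gm (u_ n)) (u_ (S n))).
  { intro n. simpl. apply hst, below. }
  (* Cofinality is stated for maps on [L], so the omega-sequence is indexed through an injection of
     [nat] into [chi], inverted by [r]. *)
  destruct (infinite_nat inf) as [f hf].
  destruct (@partial_choice L nat (fun k => exists n, proj1_sig (f n) = k)
              (fun k n => proj1_sig (f n) = k)) as [r hr].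
  { constructor; exact 0. }
  { auto. }
  destruct (cof (fun k => u_ (r k))) as [w [wa hw]]; [intros; apply below|].
  assert (bw : forall n, ltK (u_ n) w).
  { intro n. assert (e : r (proj1_sig (f n)) = n).
    { apply hf, sig_eq, hr. eauto. }
    rewrite <- e. apply hw, (proj2_sig (f n)). }
  destruct (@lub_ex (fun p => exists n, p = u_ n)) as [v [ub lst]].
  { exists w. intros p [n ->]. specialize (bw n). ord HK. }
  assert (vw : ~ ltK w v).
  { apply lst. intros p [n ->]. specialize (bw n). ord HK. }
  assert (lv : forall n, ltK (u_ n) v).
  { intro n. destruct (up n) as [_ [l _]]. assert (~ ltK v (u_ (S n))) by eauto. ord HK. }
  assert (cofin : forall c, ltK c v -> exists n, ltK c (u_ n)).
  { intros c l. apply NNPP. intro no. apply (lst c); auto. intros p [n ->] h. eauto. }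
  exists v. split; [|split; [|split]].
  - apply cl3; [ord HK|]. split; [exists u; exact (lv 0)|].
    intros c l. destruct (cofin c l) as [n hn]. destruct (up n) as [h1 [h2 _]].
    exists (u_ (S n)). split; auto. split; [ord HK|apply lv].
  - exact (lv 0).
  - ord HK.
  - intros c l. destruct (cofin c l) as [n hn]. destruct (up n) as [_ [_ h]].
    assert (l1 := hgm (u_ n) c). assert (l2 := lv (S n)).
    assert (ltK (g c) (gm (u_ n))) by (apply l1; ord HK). ord HK.
Qed.

(* Each pair [(b, xi)] is refuted at no more than one [tau], and there are fewer than [lambda]
   relevant pairs. *)
Lemma good_tau (x : K -> Prop) X mu (z : L -> data) :
  otp_le ltL ltK x -> x X ->
  exists tau, forall b xi, x b -> ltK b X -> ltK xi b -> ltL (idx b xi) mu ->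
    (forall e, ltL e tau -> forall j, G xi (Some (mu, e, j)) = next (z e) (G xi None) j) ->
    forall j, G xi (Some (mu, tau, j)) = next (z tau) (G xi None) j.
Proof.
  intros [f hf] xX. apply NNPP. intro no.
  apply (@L_not_le_seg_prod (f X) mu).
  apply card_le_rel with (R := fun tau p => exists b xi,
    (x b /\ ltK xi b /\ f b = proj1_sig (fst p) /\ idx b xi = proj1_sig (snd p)) /\
    (forall e, ltL e tau -> forall j, G xi (Some (mu, e, j)) = next (z e) (G xi None) j) /\
    ~ (forall j, G xi (Some (mu, tau, j)) = next (z tau) (G xi None) j)).
  - intro tau. apply NNPP. intro no'. apply no. exists tau.
    intros b xi xb bX xib lm ag. apply NNPP. intro dis. apply no'.
    exists (exist (fun t => ltL t (f X)) (f b) (hf b X xb xX bX),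
            exist (fun t => ltL t mu) (idx b xi) lm).
    exists b, xi. simpl. auto.
  - intros t t' p [b [xi [[h1 [h2 [h3 h4]]] [h5 h6]]]] [b' [xi' [[k1 [k2 [k3 k4]]] [k5 k6]]]].
    assert (eb : b = b').
    { destruct (wo_tri HK b b') as [l|[l|l]]; auto.
      - assert (l' := hf b b' h1 k1 l). rewrite h3, k3 in l'. ord HL.
      - assert (l' := hf b' b k1 h1 l). rewrite h3, k3 in l'. ord HL. }
    subst b'.
    assert (ex : xi = xi') by (apply (idx_inj (b := b)); auto; congruence).
    subst xi'. destruct (wo_tri HL t t') as [l|[l|l]]; auto.
    + destruct h6. apply k5, l.
    + destruct k6. apply h5, l.
Qed.

(** This settles a single [theta]. The bound [X] below [a] is recorded so that the walk can later be
    cut after its first [theta] stops. *)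
Lemma guessing (C : K -> K -> Prop) (S : K -> Prop) (theta chi : L) :
  square_seq ltL ltK C -> is_limit ltL theta -> ~ finite (seg ltL chi) ->
  (forall j : L -> L, exists mu (e : L -> L),
    (forall k, ltL k theta -> ltL (e k) chi) /\
    (forall k k', ltL k k' -> ltL k' theta -> ltL (e k) (e k')) /\
    (forall k, ltL k theta -> ltL (j (e k)) mu)) ->
  (forall a, S a -> cof_gt chi a) -> stationary S ->
  exists W, (forall o i s b n, W o i s b n -> ltK s n /\ ltK n b) /\
    forall (A : L -> K -> Prop) (D : K -> Prop), (forall i, unbounded ltK (A i)) -> club ltK D ->
    exists a X, S a /\ ltK X a /\ forall i, ltL i theta ->
      (alive W (C a) i /\ ~ ltK X (run W (C a) i)) /\
      A i (new_point W (C a) i) /\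
      exists d, D d /\ ltK (run_sup W (C a) i) d /\ ltK d (new_point W (C a) i).
Proof.
  intros sq limt inf pig Scof Sst. apply NNPP. intro no.
  pose (fails := fun W (z : data) =>
    ((forall i, unbounded ltK (fst z i)) /\ club ltK (snd z)) /\
    ~ exists a X, S a /\ ltK X a /\ forall i, ltL i theta ->
      (alive W (C a) i /\ ~ ltK X (run W (C a) i)) /\
      fst z i (new_point W (C a) i) /\
      exists d, snd z d /\ ltK (run_sup W (C a) i) d /\ ltK d (new_point W (C a) i)).
  assert (counter : forall mu tau z, exists z', fails (guess mu tau z) z').
  { intros mu tau z. apply NNPP. intro no'. apply no. exists (guess mu tau z). split.
    - intros o i s b n [h _]. exact h.
    - intros A D hA hD. apply NNPP. intro no2. apply no'. exists (A, D). split; auto. }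
  (* For each [mu], counterexamples are chosen by recursion on [tau], since [guess mu tau] sees only
     those before [tau]. *)
  destruct (func_choice (fun mu (z : L -> data) => forall tau, fails (guess mu tau z) (z tau)))
    as [Z hZ].
  { intro mu.
    apply (@wf_rec_choice L data ltL (fun tau z z' => fails (guess mu tau z) z')).
    - constructor. exact (fun _ _ => True, fun _ => True).
    - apply (wo_wf HL).
    - apply counter.
    - intros tau z z' v e h. rewrite <- (guess_ext mu z z' e). exact h. }
  assert (nx : forall mu tau g i, fst (Z mu tau) i (next (Z mu tau) g i) /\
     exists d, snd (Z mu tau) d /\ ltK g d /\ ltK d (next (Z mu tau) g i)).
  { intros mu tau g i. destruct (hZ mu tau) as [[h1 h2] _]. apply next_spec; auto. }
  (* [code g] is the conjecture with parameter [g] that is right about all counterexamples at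
     once. *)
  destruct (func_choice (fun g xi => G xi = fun o => match o with
     | None => g | Some (mu, tau, i) => next (Z mu tau) g i end)) as [code hcode].
  { intro g. apply G_onto. }
  (* At a point closed under [g] and above [v], the conjecture [code v] is available and its
     predictions fit below the point. *)
  destruct (func_choice (fun v u => ltK (code v) u /\ forall mu tau i, ltK (next (Z mu tau) v i) u))
    as [g hg].
  { intro v.
    destruct (@K_bound (L * L * L)
      (fun p => next (Z (fst (fst p)) (snd (fst p))) v (snd p)) L_cube) as [u hu].
    assert (hu' : forall mu tau i, ltK (next (Z mu tau) v i) u).
    { intros mu tau i. exact (hu (mu, tau, i)). }
    destruct (K_unbounded (code v)) as [w hw].
    destruct (classic (ltK u w)) as [h|h].
    - exists w. split; auto. intros mu tau i. specialize (hu' mu tau i). ord HK.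
    - exists u. split; auto. ord HK. }
  destruct (monotone_majorant g) as [gm hgm].
  destruct (Sst gm) as [a [Sa cla]].
  assert (cof := Scof a Sa). assert (lim := proj1 cof).
  assert (pts := closed_points g sq inf cof hgm cla).
  set (x := C a) in *.
  destruct (sq a lim) as [[xa [_ _]] [otp _]]. fold x in xa, otp.
  destruct lim as [[u0 hu0] lim'].
  (* Successive pairs in [C a] for [k] up to and including [chi]: the first component is a
     parameter, the second a point closed under [g]. The pair at [chi] provides [X]. *)
  destruct (@wf_rec_choice L (K * K) ltL (fun k p q => ~ ltL chi k ->
     (forall l, ltL l k -> ltK (snd (p l)) a) ->
     (x (fst q) /\ x (snd q) /\ closed_under g (snd q) /\ ltK (fst q) (snd q) /\ ltK (snd q) a) /\
     forall l, ltL l k -> ltK (snd (p l)) (fst q))) as [p hp].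
  { constructor. exact (u0, u0). }
  { apply (wo_wf HL). }
  { intros k p. destruct (classic (~ ltL chi k /\ forall l, ltL l k -> ltK (snd (p l)) a))
      as [[h1 h2]|nh]; [|exists (u0, u0); tauto].
    destruct cof as [_ cof].
    destruct (cof (fun l => if excluded_middle_informative (ltL l k) then snd (p l) else u0))
      as [u [ua hu]].
    { intros l _. destruct (excluded_middle_informative _); auto. }
    destruct (pts u ua) as [c [c1 [c2 [c3 _]]]]. destruct (pts c c3) as [b [b1 [b2 [b3 b4]]]].
    exists (c, b). intros _ _. split; [repeat (split; auto)|]. simpl.
    intros l lk. assert (lc : ltL l chi) by ord HL. specialize (hu l lc). simpl in hu.
    destruct (excluded_middle_informative _); [|contradiction]. ord HK. }
  { intros k p p' q e h h1 h2. destruct h as [h3 h4]; auto.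
    - intros l lk. rewrite (e l lk). auto.
    - split; auto. intros l lk. rewrite <- (e l lk). auto. }
  assert (hp' : forall k, ~ ltL chi k ->
     (x (fst (p k)) /\ x (snd (p k)) /\ closed_under g (snd (p k)) /\
      ltK (fst (p k)) (snd (p k)) /\ ltK (snd (p k)) a) /\
     forall l, ltL l k -> ltK (snd (p l)) (fst (p k))).
  { intro k. induction (wo_wf HL k) as [k _ IH]. intro hk. apply (hp k hk).
    intros l lk. apply IH; auto. ord HL. }
  clear hp.
  (* One [mu] bounds the indices of the correct conjectures at [theta] many pairs. *)
  destruct (pig (fun k => idx (snd (p k)) (code (fst (p k))))) as [mu [e [e1 [e2 e3]]]].
  set (X := snd (p chi)).
  destruct (hp' chi (wo_irr HL (x := chi))) as [[_ [xX [_ [topX Xa]]]] belowX].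
  fold X in xX, topX, Xa.
  destruct (@good_tau x X mu (Z mu) otp xX) as [tau htau].
  destruct (hZ mu tau) as [_ bad]. apply bad. clear bad.
  set (W := guess mu tau (Z mu)).
  assert (Wb : forall o i s b n, W o i s b n -> ltK s n /\ ltK n b) by (intros o i s b n h; apply h).
  (* Each selected pair catches a stop: at the first stage that does not stop at or below [c], the
     point [b] is a candidate by virtue of [code c]. *)
  assert (reach : forall k, ltL k theta -> exists i, alive W x i /\
     ltK (fst (p (e k))) (run W x i) /\ ~ ltK (snd (p (e k))) (run W x i)).
  { intros k hk. assert (ek := e1 k hk).
    destruct (hp' (e k)) as [[x1 [x2 [x3 [x4 x5]]]] _]; [ord HL|].
    assert (lX := belowX _ ek).
    set (c := fst (p (e k))) in *. set (b := snd (p (e k))) in *.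
    destruct (@wo_least L ltL (fun i => ~ (alive W x i /\ ~ ltK c (run W x i))) HL) as [i [hi mini]].
    (* Otherwise the stops form an increasing [L]-sequence below [X], against the order type of
       [C a]. *)
    { apply NNPP. intro all.
      assert (all' : forall i, alive W x i /\ ~ ltK c (run W x i)) by (intro; apply NNPP; eauto).
      destruct otp as [f hf].
      apply (L_strict_expansive (fun i => f (run W x i))) with (i := f X).
      - intros i j l. apply hf.
        + apply (run_alive), all'.
        + apply (run_alive), all'.
        + apply (run_incr); [exact l|apply all'].
      - destruct (all' (f X)) as [h1 h2]. apply hf; auto.
        + apply (run_alive), h1.
        + ord HK. }
    assert (before : forall j, ltL j i -> alive W x j /\ ~ ltK c (run W x j)).
    { intros j l. apply NNPP. intro h. exact (mini j h l). }
    assert (sc : ~ ltK c (run_sup W x i)).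
    { unfold run_sup. apply sup_below_spec.
      - apply (least_spec x); eauto.
      - intros j l. apply before, l. }
    assert (cd : cand W x i (run_sup W x i) b).
    { split; auto. split; [ord HK|]. exists (next (Z mu tau) c i).
      assert (cc := x3 c x4). destruct (hg c) as [g1 g2]. specialize (g2 mu tau i).
      destruct (nx mu tau c i) as [_ [d [_ [d1 d2]]]].
      assert (hc := hcode c). split; [split; ord HK|].
      exists (code c). rewrite hc. repeat split; auto; try ord HK. apply e3, hk. }
    assert (al : alive W x i).
    { intros j nl. destruct (wo_tri HL j i) as [l|[->|l]].
      - destruct (before j l) as [h _]. apply h. ord HL.
      - eauto.
      - contradiction. }
    exists i. split; auto. split.
    - apply NNPP. intro h. apply hi. auto.
    - apply (run_alive al), cd. }
  destruct (@partial_choice L L (fun k => ltL k theta) (fun k i => alive W x i /\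
     ltK (fst (p (e k))) (run W x i) /\ ~ ltK (snd (p (e k))) (run W x i)) L_inhabited reach)
    as [I hI].
  (* Later pairs are reached at later stages, so [I] is increasing, [I k] is at least [k], and the
     walk makes [theta] stops below [X]. *)
  assert (Iinc : forall k k', ltL k k' -> ltL k' theta -> ltL (I k) (I k')).
  { intros k k' l hk'. assert (hk : ltL k theta) by ord HL.
    destruct (hI k hk) as [al [_ h2]]. destruct (hI k' hk') as [al' [h3 _]].
    destruct (hp' (e k')) as [_ h4]; [specialize (e1 k' hk'); ord HL|].
    specialize (h4 (e k) (e2 k k' l hk')).
    apply NNPP. intro n. destruct (wo_tri HL (I k) (I k')) as [t|[t|t]]; [contradiction| |].
    - rewrite t in *. ord HK.
    - assert (h := run_incr t al). ord HK. }
  assert (Iexp : forall k, ltL k theta -> ~ ltL (I k) k).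
  { intro k. induction (wo_wf HL k) as [k _ IH]. intros hk l.
    apply (IH (I k) l); [ord HL|]. apply Iinc; auto. }
  assert (live : forall k, ltL k theta -> alive W x k /\ ltK (run W x k) X).
  { intros k hk. destruct (hI k hk) as [al [_ h]]. assert (n := Iexp k hk).
    assert (alk : alive W x k) by (apply (alive_down al), n).
    split; auto. assert (lX := belowX _ (e1 k hk)).
    destruct (wo_tri HL k (I k)) as [t|[t|t]]; [|rewrite <- t in h; ord HK|contradiction].
    assert (h' := run_incr t al). ord HK. }
  exists a, X. split; auto. split; auto. intros i hi. fold x.
  destruct (live i hi) as [al rX].
  destruct (run_alive al) as [h1 [h2 [h3 _]]].
  assert (h3' := h3). destruct h3' as [_ [xi [k1 [k2 [k3 [k4 k5]]]]]].
  (* The conjecture used at stage [i] has index below [mu] at a stop below [X], so by the choice of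
     [tau] it is still right at [tau]. *)
  rewrite (htau _ xi h1 rX k1 k2 k4 i) in k5.
  destruct (nx mu tau (G xi None) i) as [n1 [d [n2 [n3 n4]]]].
  rewrite <- k5 in n1, n4.
  split; [split|split]; auto; [ord HK|]. exists d. split; auto. split; auto. ord HK.
Qed.
End Guessing.

(** * One sequence for all lengths [theta] *)

Lemma clubsuit_of_square (G : K -> option (L * L * L) -> K) :
  (forall F, exists xi, G xi = F) -> square ltL ltK -> clubsuit_square ltL ltK.
Proof.
  intros G_onto [C0 sq0].
  destruct (func_choice (fun b (f : K -> L) =>
    forall x y, ltK x b -> ltK y b -> f x = f y -> x = y)) as [idx idx_inj].
  { intro b. destruct (Kseg b) as [f hf]. destruct L_inhabited as [l0].
    exists (fun x => match excluded_middle_informative (ltK x b) with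
                     | left h => f (exist _ x h) | right _ => l0 end).
    intros x y hx hy e.
    destruct (excluded_middle_informative (ltK x b)); [|contradiction].
    destruct (excluded_middle_informative (ltK y b)); [|contradiction].
    apply hf in e. injection e; auto. }
  destruct (@partial_choice L L (fun theta => ~ finite (seg ltL theta)) (fun theta chi =>
    ~ finite (seg ltL chi) /\ forall j : L -> L, exists mu (e : L -> L),
    (forall k, ltL k theta -> ltL (e k) chi) /\
    (forall k k', ltL k k' -> ltL k' theta -> ltL (e k) (e k')) /\
    (forall k, ltL k theta -> ltL (j (e k)) mu)) L_inhabited bounded_on_subset) as [chi hchi].
  destruct (coherent_codes chi sq0) as [C [code [sq st]]].
  destruct (@partial_choice L (K -> L -> K -> K -> K -> Prop) (is_limit ltL) (fun theta W =>
    (forall o i s b n, W o i s b n -> ltK s n /\ ltK n b) /\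
    forall (A : L -> K -> Prop) (D : K -> Prop), (forall i, unbounded ltK (A i)) -> club ltK D ->
    exists a X, (cof_gt (chi theta) a /\ code (least (C a)) = theta) /\
      ltK X a /\ forall i, ltL i theta ->
      (alive W (C a) i /\ ~ ltK X (run W (C a) i)) /\
      A i (new_point W (C a) i) /\
      exists d, D d /\ ltK (run_sup W (C a) i) d /\ ltK d (new_point W (C a) i)))
    as [Ws hWs].
  { constructor. exact (fun _ _ _ _ _ => True). }
  { intros theta lim. destruct (hchi theta (limit_infinite lim)) as [inf pig].
    apply (@guessing G G_onto idx idx_inj C _ theta (chi theta) sq lim inf pig); auto. intros a h; apply h. }
  (* The length is read off the minimum. The added inequalities are needed for codes that are not
     limits, where [Ws] is arbitrary. *)
  pose (W := fun o i s b n => Ws (code o) o i s b n /\ ltK s n /\ ltK n b).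
  assert (Wb : forall o i s b n, W o i s b n -> ltK s n /\ ltK n b) by (intros o i s b n h; apply h).
  assert (par : forall a theta, is_limit ltL theta -> code (least (C a)) = theta ->
             W (least (C a)) = Ws theta (least (C a))).
  { intros a theta lim e. unfold W. rewrite e. destruct (hWs theta lim) as [h _].
    extensionality i. extensionality s. extensionality b. extensionality n.
    apply propositional_extensionality. split; [tauto|]. intro w. split; auto. eapply h, w. }
  exists (post W C). split; [apply (post_square W Wb sq)|].
  intros A hA theta limt D hD.
  destruct (proj2 (hWs theta limt) A D hA hD) as [a [X [[cof ea] [Xa hX]]]].
  destruct (run_param W (Ws theta) (C a) (par a theta limt ea)) as [er [es [en eal]]].
  assert (hal : forall i, ltL i theta -> alive W (C a) i).
  { intros i l. apply eal, hX, l. }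
  destruct (@post_enumerates W Wb C sq a theta X) as [v [limv env]]; auto.
  { apply cof. }
  { intros i l. split; auto. rewrite er. apply hX, l. }
  exists v. split; auto. exists (new_sup W (C a)). split; auto.
  intros i j l sc. rewrite (new_sup_succ Wb sc (hal i l)).
  destruct (hX i l) as [_ [h1 [d [h2 [h3 h4]]]]]. rewrite <- en in h1, h4. rewrite <- es in h3.
  split; auto. exists d. split; auto. split; auto.
  (* The point of [D] was found above the earlier stops, which dominate the earlier new points. *)
  assert (h : ~ ltK (run_sup W (C a) i) (new_sup W (C a) i)).
  { apply (new_sup_le_run_sup Wb). intros k lk. apply hal. ord HL. }
  ord HK.
Qed.
End Successor.

(* An element of [K] is read as a function [L -> L], and the latter as a function on [Y * L]. *)
Lemma enumerate_arrays (L K Y : Type) : inhabited L -> card_le (Y * L) L -> card_eq (L -> L) K ->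
  exists G : K -> Y -> K, forall F, exists xi, G xi = F.
Proof.
  intros exL [p hp] [f [g [gf fg]]].
  exists (fun xi y => f (fun l => g xi (p (y, l)))). intro F.
  destruct (@partial_choice L L (fun m => exists y l, p (y, l) = m)
    (fun m v => exists y l, p (y, l) = m /\ v = g (F y) l) exL) as [h hh].
  { intros m [y [l e]]. eauto. }
  exists (f h). extensionality y. rewrite <- (fg (F y)). f_equal. extensionality l.
  rewrite gf. destruct (hh (p (y, l))) as [y' [l' [e ->]]]; [eauto|].
  apply hp in e. injection e as -> ->. reflexivity.
Qed.

Theorem theoremB (L : Type) (ltL : L -> L -> Prop) (K : Type) (ltK : K -> K -> Prop) :
  is_cardinal ltL -> uncountable L ->
  is_successor_cardinal_of ltL ltK ->
  ((limit_cardinal ltL /\ card_eq (L -> L) K) \/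
   (successor_cardinal ltL /\ card_lt (lt_power ltL) (L -> L) /\ card_eq (L -> L) K)) ->
  square ltL ltK -> clubsuit_square ltL ltK.
Proof.
  intros cL unc [cK [[_ big] segs]] arith.
  assert (eq : card_eq (L -> L) K) by tauto.
  assert (inf : ~ finite L) by (intro fin; apply unc, finite_countable, fin).
  assert (id := hessenberg cL inf).
  assert (exL : inhabited L).
  { destruct (infinite_nat inf) as [f _]. constructor; exact (f 0). }
  assert (cY : card_le (option (L * L * L) * L) L).
  { apply card_le_trans with (2 := id). apply card_le_prod; [|apply card_le_refl].
    apply card_le_trans with (option L); [|apply idem_option; auto].
    apply card_le_option. apply card_le_trans with (2 := id).
    apply card_le_prod; [exact id|apply card_le_refl]. }
  destruct (enumerate_arrays exL cY eq) as [G hG].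
  exact (clubsuit_of_square (proj1 cL) (proj1 cK) (proj2 cL) inf segs big G hG).
Qed.
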